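(* Let $\varphi$ be a holomorphic self-map of $\mathbb{B}_N$ and let $\psi$ be a holomorphic function on $\mathbb{B}_N$ such that the weighted composition operator $W_{\psi,\varphi}$ is bounded on $\mathcal{D}(\mathbb{B}_N)$. Then $W_{\psi,\varphi}$ is complex symmetric with conjugation $J$ on $\mathcal{D}(\mathbb{B}_N)$ if and only if $\psi(z)=c$ and $\varphi(z)=\varphi'(0)z$ for all $z\in\mathbb{B}_N$, where $c$ is a constant and $\varphi'(0)$ is a symmetric matrix with $\|\varphi'(0)\|\le 1$.
   Context: $\mathbb{B}_N$ is the open unit ball of $\mathbb{C}^N$ and $\langle\cdot,\cdot\rangle$ is the Euclidean inner product on $\mathbb{C}^N$ (linear in the first variable). $\mathcal{D}(\mathbb{B}_N)$ (the Dirichlet space) is the Hilbert space of holomorphic functions on $\mathbb{B}_N$ with reproducing kernel $K_w(z)=1+\ln\frac{1}{1-\langle z,w\rangle}$, i.e. $f(w)=\langle f,K_w\rangle$ for all $f\in\mathcal{D}(\mathbb{B}_N)$, $w\in\mathbb{B}_N$. $W_{\psi,\varphi}f=\psi\cdot(f\circ\varphi)$. $J$ is the conjugation $(Jf)(z)=\overline{f(\overline{z})}$, where $\overline z$ is the coordinatewise conjugate. A bounded operator $T$ is complex symmetric with conjugation $C$ ($C$ an anti-linear isometric involution: $C^2=I$, $\langle Cx,Cy\rangle=\langle y,x\rangle$) if $TC=CT^*$. $\varphi'(0)$ is the $N\times N$ complex Jacobian matrix of $\varphi$ at $0$; ''symmetric'' means equal to its transpose; $\|\cdot\|$ is the operator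 norm on $\mathbb{C}^N$.
   Formalization: The formal theorem also assumes that ψ is not identically zero and that φ is not a nonzero constant map; the ''only if'' direction fails for ψ = 0 with φ nonlinear, and for φ ≡ a ≠ 0 with ψ the reproducing kernel at the conjugate of a. *)

(* Defs.v *)
From HB Require Import structures.
From mathcomp Require Import all_boot all_order all_algebra.
From mathcomp Require Import complex.
From mathcomp Require Import all_classical all_reals all_analysis.

Set Implicit Arguments.
Unset Strict Implicit.
Unset Printing Implicit Defensive.

Import Order.TTheory GRing.Theory Num.Theory.
Import numFieldNormedType.Exports.

Local Open Scope classical_set_scope.
Local Open Scope ring_scope.
Local Open Scope complex_scope.

(* The usual topology and norm on the field of complex numbers. *)
HB.instance Definition _ (R : realType) := NormedModule.copy R[i] (R[i])^o.

Section ComplexLogarithm.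
Variable R : realType.

Definition cabs (z : R[i]) : R := complex.Re `|z|.

(* Principal argument, in ]-pi, pi] for z != 0. *)
Definition carg (z : R[i]) : R :=
  if 0 <= complex.Im z then acos (complex.Re z / cabs z)
  else - acos (complex.Re z / cabs z).

Definition cln (z : R[i]) : R[i] := ln (cabs z) +i* carg z.

End ComplexLogarithm.

Section EuclideanSpace.
Variables (R : realType) (N : nat).
Implicit Types z w : 'cV[R[i]]_N.

Definition cdot z w : R[i] := \sum_(i < N) z i 0 * (w i 0)^*.

Definition enorm z : R := Num.sqrt (complex.Re (cdot z z)).

Definition opnorm (A : 'M[R[i]]_N) : R :=
  sup [set enorm (A *m z) | z in [set z | enorm z <= 1]].

Definition unit_ball : pred 'cV[R[i]]_N := fun z => enorm z < 1.

End EuclideanSpace.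

Definition ballT (R : realType) (N : nat) : Type :=
  {z : 'cV[R[i]]_N | unit_ball z}.

Section Ball.
Variables (R : realType) (N : nat).
Local Notation C := (R[i]).
Local Notation B := (ballT R N).

Lemma unit_ball_conj (z : B) : unit_ball (map_mx (@Num.conj R[i]) (val z)).
Proof.
case: z => z /= zB; rewrite /unit_ball /enorm.
suff -> : cdot (map_mx (@Num.conj R[i]) z) (map_mx (@Num.conj R[i]) z) =
    cdot z z by [].
by apply: eq_bigr => i _; rewrite !mxE conjCK mulrC.
Qed.

Definition conjB (z : B) : B :=
  exist (fun w : 'cV[C]_N => unit_ball w) _ (unit_ball_conj z).

(* Extension by 0 outside the ball.  As the ball is open, the value chosen
   outside does not affect derivatives at points of the ball. *)
Definition ext0 (V : zmodType) (f : B -> V) (z : 'cV[C]_N) : V :=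
  oapp f 0 (insub z).

(* The scalar field of 'cV[C]_N and V being C, this is complex
   differentiability. *)
Definition holomorphic (V : normedModType C) (f : B -> V) : Prop :=
  forall z : B, differentiable (ext0 f) (val z).

Definition holomorphic_self_map (phi : B -> B) : Prop :=
  holomorphic (fun z => val (phi z)).

Definition jacobian0 (phi : B -> B) : 'M[C]_N :=
  \matrix_(i < N, j < N)
    ('D_(delta_mx j 0) (ext0 (fun z => (val (phi z) i 0 : C))) 0).

End Ball.

Section HilbertSpaces.
Variables (R : realType) (V : lmodType R[i]).
Local Notation C := (R[i]).
Variables (D : set V) (ip : V -> V -> C).

Definition hnorm (f : V) : R := Num.sqrt (complex.Re (ip f f)).

(* The subspace D of V is a Hilbert space for ip; the values of ip outside
   D x D are irrelevant. *)
Record hilbert_space : Prop := HilbertSpace {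
  hilbert0 : D 0;
  hilbert_lin : forall (a : C) f g, D f -> D g -> D (a *: f + g);
  ip_linl : forall (a : C) f g h, D f -> D g -> D h ->
    ip (a *: f + g) h = a * ip f h + ip g h;
  ip_conj : forall f g, D f -> D g -> ip g f = (ip f g)^*;
  ip_pos : forall f, D f -> f != 0 -> 0 < ip f f;
  hilbert_complete : forall u : nat -> V, (forall n, D (u n)) ->
    (forall e : R, 0 < e -> exists n0, forall m n,
       (n0 <= m)%N -> (n0 <= n)%N -> hnorm (u m - u n) < e) ->
    exists2 l, D l & forall e : R, 0 < e -> exists n0, forall n,
       (n0 <= n)%N -> hnorm (u n - l) < e }.

Record bounded_operator (T : V -> V) : Prop := BoundedOperator {
  bop_stable : forall f, D f -> D (T f);
  bop_lin : forall (a : C) f g, D f -> D g ->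
    T (a *: f + g) = a *: T f + T g;
  bop_bound : exists M : R, forall f, D f -> hnorm (T f) <= M * hnorm f }.

Definition is_adjoint (T S : V -> V) : Prop :=
  (forall f, D f -> D (S f)) /\
  (forall f g, D f -> D g -> ip (T f) g = ip f (S g)).

Record conjugation (K : V -> V) : Prop := Conjugation {
  conj_stable : forall f, D f -> D (K f);
  conj_antilin : forall (a : C) f g, D f -> D g ->
    K (a *: f + g) = a^* *: K f + K g;
  conj_invol : forall f, D f -> K (K f) = f;
  conj_isom : forall f g, D f -> D g -> ip (K f) (K g) = ip g f }.

(* The adjoint S of T is unique on D. *)
Definition complex_symmetric (T K : V -> V) : Prop :=
  conjugation K /\
  exists2 S, is_adjoint T S & forall f, D f -> T (K f) = K (S f).

End HilbertSpaces.

Section DirichletSpace.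
Variables (R : realType) (N : nat).
Local Notation C := (R[i]).
Local Notation B := (ballT R N).

Definition dirichlet_kernel (w z : B) : C :=
  1 + cln (1 / (1 - cdot (val z) (val w))).

(* A reproducing kernel determines the Hilbert space of functions, so at most
   one D, with one inner product on it, satisfies this predicate.  The kernel
   is positive definite, as it has the expansion
   1 + \sum_(n >= 1) <z, w> ^+ n / n, hence there is one. *)
Record dirichlet_space (D : set (B -> C)) (ip : (B -> C) -> (B -> C) -> C) :
    Prop := DirichletSpace {
  dirichlet_hilbert : hilbert_space D ip;
  dirichlet_holomorphic : forall f : B -> C, D f ->
    holomorphic (f : B -> C);
  dirichlet_kernel_in : forall w, D (dirichlet_kernel w);
  dirichlet_reproducing : forall f w, D f -> f w = ip f (dirichlet_kernel w) }.

Definition weighted_comp (psi : B -> C) (phi : B -> B) (f : B -> C) : B -> C :=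
  fun z => psi z * f (phi z).

Definition conjJ (f : B -> C) : B -> C := fun z => (f (conjB z))^*.

End DirichletSpace.

(* Main.v *)
(* Write L(x) = ln (1 / (1 - x)), P = 1 + L, and [a, b] for the bilinear form
   sum_i a_i b_i.  As J K_w is the kernel at the conjugate of w, testing W J = J W*
   on kernels gives, for all z and w in the ball,
     psi(z) P([phi(z), w]) = psi(w) P([phi(w), z]),
   hence psi(z) = psi(0) P([a, z]) with a = phi(0).  Put s = [a, z], t = [a, w].
   Differentiating in w at 0 shows that
     (1 - s) P(s) [phi(z) - a, w] =: b(z, w)
   is linear in z.  Since L(x + h) = L(x) + L(h / (1 - x)), the identity becomes
     P(s) L(y / P(s)) = P(t) L(y' / P(t)),
   where y and y' are the quotients of b(z, w) and b(w, z) by (1 - s)(1 - t).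
   Scaling w to 0 and comparing the terms of order 1 and 2, where
   L(x) = x + x^2 / 2 + o(x^2), yields b(z, w) = b(w, z), and P(s) = 1 unless
   b(z, w) = 0.  Thus [a, z] <> 0 implies phi(z) = a, and then phi = a everywhere
   when a <> 0, which is excluded.  So a = 0, psi is constant, and the injectivity
   of L gives [phi(z), w] = [phi(w), z], i.e. phi is linear and symmetric.
   Conversely the same computation shows that the adjoint of W agrees with J W J
   on the kernels, hence everywhere by density. *)
Require Import Defs.
From HB Require Import structures.
From mathcomp Require Import all_boot all_order all_algebra.
From mathcomp Require Import complex.
From mathcomp Require Import all_classical all_reals all_analysis.
From mathcomp Require Import ring lra.

Set Implicit Arguments.
Unset Strict Implicit.
Unset Printing Implicit Defensive.

Import Order.TTheory GRing.Theory Num.Theory.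
Import numFieldNormedType.Exports Normc.

Local Open Scope classical_set_scope.
Local Open Scope ring_scope.
Local Open Scope complex_scope.

(** * Taylor estimates for real functions *)
Section RealTaylor.
Variable R : realType.
Implicit Types (f df : R -> R) (x : R).

(** The derivative of each remainder below is, up to sign, a function already bounded. So the order
    rises one degree at a time, at the cost of the factorials. *)
Lemma MVT_norm_le f df x (M : R) : f 0 = 0 ->
  (forall y : R, is_derive y 1 f (df y)) ->
  (forall y, `|y| <= `|x| -> `|df y| <= M) -> `|f x| <= M * `|x|.
Proof.
move=> f0 fdf dfM.
have fc a b : {within `[a, b], continuous f}.
  apply: derivable_within_continuous => y _. by have [] := fdf y.
have [x0|/ltW x0] := leP 0 x.
- have [c] := MVT_segment x0 (fun y _ => fdf y) (fc _ _).
  rewrite in_itv /= f0 subr0 => /andP[c0 cx] ->.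
  rewrite subr0 normrM ler_wpM2r// dfM//.
  by rewrite !ger0_norm.
- have [c] := MVT_segment x0 (fun y _ => fdf y) (fc _ _).
  rewrite in_itv /= f0 sub0r => /andP[xc c0].
  move=> /(congr1 (fun y => `|y|)); rewrite normrN sub0r normrM normrN => ->.
  rewrite ler_wpM2r// dfM//.
  by rewrite !ler0_norm// lerN2.
Qed.

Lemma sin_le_norm x : `|sin x| <= `|x|.
Proof.
rewrite -[leRHS]mul1r; apply: (@MVT_norm_le _ cos); first exact: sin0.

by move=> y _; exact: cos_max.
Qed.

Lemma cos_sub1_le x : `|cos x - 1| <= `|x| ^+ 2.
Proof.
rewrite expr2; apply: (@MVT_norm_le (fun y => cos y - 1) (fun y => - sin y)).
- by rewrite cos0 subrr.
- move=> y; apply: is_derive_eq; rewrite ?subr0 //. rewrite ?subr0 //.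
- by move=> y yx; rewrite normrN (le_trans (sin_le_norm _)).
Qed.

Lemma sin_subx_le x : `|sin x - x| <= `|x| ^+ 3.
Proof.
rewrite exprSr; apply: (@MVT_norm_le (fun y => sin y - y) (fun y => cos y - 1)).
- by rewrite sin0 subrr.
- move=> y yx; rewrite (le_trans (cos_sub1_le _))//.
  by rewrite lerXn2r ?nnegrE.
Qed.

Lemma cos_taylor2_le x : `|cos x - 1 + x ^+ 2 / 2| <= `|x| ^+ 4.
Proof.
rewrite [leRHS]exprSr.
apply: (@MVT_norm_le (fun y => cos y - 1 + y ^+ 2 / 2) (fun y => y - sin y)).
- by rewrite cos0 subrr expr0n /= mul0r addr0.
- move=> y; apply: is_derive_eq.
  by rewrite !scaler0 add0r /GRing.scale /=; field.
- move=> y yx; rewrite distrC (le_trans (sin_subx_le _))//.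
  by rewrite lerXn2r ?nnegrE.
Qed.

(** The inverse of [expR 2^-1] is at least 1 - 1/2, so [expR 2^-1] is at most 2; squaring bounds
    [expR 1]. *)
Lemma expR_le4 x : x <= 1 -> expR x <= 4.
Proof.
move=> x1; apply: (@le_trans _ _ (expR (2^-1 + 2^-1))).
  rewrite ler_expR; lra.
rewrite expRD; have h : expR (2^-1 : R) <= 2.
  have := expR_ge1Dx (- 2^-1 : R); rewrite expRN.
  have := expR_gt0 (2^-1 : R); set e := expR _ => e0 he.
  have : e^-1 * e = 1 by rewrite mulVf ?gt_eqF.
  have : 0 < e^-1 by rewrite invr_gt0.
  nra.
have := expR_gt0 (2^-1 : R); nra.
Qed.

Lemma expR_sub1_le x : `|x| <= 1 -> `|expR x - 1| <= 4 * `|x|.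
Proof.
move=> x1; apply: (@MVT_norm_le (fun y => expR y - 1) expR).
- by rewrite expR0 subrr.
- move=> y; apply: is_derive_eq; by rewrite subr0.
- move=> y yx; rewrite ger0_norm ?expR_ge0 ?expR_le4//.
  by rewrite (le_trans (ler_norm _))// (le_trans yx).
Qed.

Lemma expR_sub1x_le x : `|x| <= 1 -> `|expR x - 1 - x| <= 4 * `|x| ^+ 2.
Proof.
move=> x1; rewrite expr2 mulrA.
apply: (@MVT_norm_le (fun y => expR y - 1 - y) (fun y => expR y - 1)).
- by rewrite expR0 !subrr.
- move=> y; apply: is_derive_eq; by rewrite subr0.
- move=> y yx; rewrite (le_trans (expR_sub1_le _)) ?(le_trans yx)//.
  by rewrite ler_wpM2l.
Qed.

Lemma expR_taylor2_le x : `|x| <= 1 ->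
  `|expR x - 1 - x - x ^+ 2 / 2| <= 4 * `|x| ^+ 3.
Proof.
move=> x1; rewrite [leRHS](_ : _ = 4 * `|x| ^+ 2 * `|x|); last first.
  by rewrite -mulrA -exprSr.
apply: (@MVT_norm_le (fun y => expR y - 1 - y - y ^+ 2 / 2)
  (fun y => expR y - 1 - y)).
- by rewrite expR0 !subrr expr0n /= mul0r subr0.
- move=> y; apply: is_derive_eq.
  by rewrite !scaler0 add0r /GRing.scale /=; field.
- move=> y yx; rewrite (le_trans (expR_sub1x_le _)) ?(le_trans yx)//.
  by rewrite ler_wpM2l ?lerXn2r ?nnegrE.
Qed.

End RealTaylor.

(** * The complex logarithm *)
Section ComplexLog.
Variable R : realType.
Local Notation C := R[i].
Implicit Types x y z v w s h : C.

Lemma normc_sqrt z : normc z = Num.sqrt (complex.Re z ^+ 2 + complex.Im z ^+ 2).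
Proof. by case: z. Qed.

Lemma normc_ge0 z : 0 <= normc z.
Proof. by rewrite normc_sqrt sqrtr_ge0. Qed.

Lemma sqr_normcE z : normc z ^+ 2 = complex.Re z ^+ 2 + complex.Im z ^+ 2.
Proof. by rewrite normc_sqrt sqr_sqrtr// addr_ge0 ?sqr_ge0. Qed.

Lemma normc_gt0 z : (0 < normc z) = (z != 0).
Proof.
rewrite lt_def normc_ge0 andbT; congr (~~ _).
by apply/eqP/eqP => [/eq0_normc|->]; rewrite ?normc0.
Qed.

Lemma normc2 : normc (2 : C) = 2.
Proof.
have -> : (2 : C) = (2 : R)%:C by rewrite rmorph_nat.
by rewrite /= expr0n addr0 sqrtr_sqr ger0_norm.
Qed.

Lemma Re_le_normc z : `|complex.Re z| <= normc z.
Proof.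
by rewrite normc_sqrt -sqrtr_sqr ler_wsqrtr// lerDl sqr_ge0.
Qed.

Lemma Im_le_normc z : `|complex.Im z| <= normc z.
Proof.
by rewrite normc_sqrt -sqrtr_sqr ler_wsqrtr// lerDr sqr_ge0.
Qed.

Lemma normc_le_ReIm z : normc z <= `|complex.Re z| + `|complex.Im z|.
Proof.
rewrite -(@ler_pXn2r _ 2%N)// ?nnegrE ?normc_ge0 ?addr_ge0//.
rewrite sqr_normcE sqrrD !real_normK ?num_real// addrAC lerDl.
by rewrite mulrn_wge0// mulr_ge0.
Qed.

(** Identities for [cln] are proved by comparing exponentials and checking that imaginary parts stay
    in the principal strip. *)
Definition cexp w : C :=
  (expR (complex.Re w) * cos (complex.Im w)) +i*
  (expR (complex.Re w) * sin (complex.Im w)).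

Lemma cexpD v w : cexp (v + w) = cexp v * cexp w.
Proof.
case: v w => [a b] [c d]; rewrite /cexp /= expRD sinD cosD.
apply/eqP; rewrite eq_complex /=; apply/andP; split; apply/eqP; ring.
Qed.

Lemma cexp0 : cexp 0 = 1.
Proof. by rewrite /cexp /= expR0 cos0 sin0 mulr1 mulr0. Qed.

Lemma cexpN w : cexp (- w) = (cexp w)^-1.
Proof.
have e1 : cexp w * cexp (- w) = 1 by rewrite -cexpD subrr cexp0.
have e0 : cexp w != 0.
  by apply/eqP => e0; move/eqP: e1; rewrite e0 mul0r eq_sym oner_eq0.
by apply: (mulfI e0); rewrite e1 mulfV.
Qed.

Lemma normc_cexp w : normc (cexp w) = expR (complex.Re w).
Proof.
rewrite normc_sqrt /= !exprMn -mulrDr cos2Dsin2 mulr1 sqrtr_sqr.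
by rewrite ger0_norm ?expR_ge0.
Qed.

Lemma Re_div_normc z : z != 0 -> -1 <= complex.Re z / normc z <= 1.
Proof.
rewrite -normc_gt0 => z0; rewrite -ler_norml normrM normfV.
by rewrite (ger0_norm (normc_ge0 z)) ler_pdivrMr// mul1r Re_le_normc.
Qed.

Lemma cos_carg z : z != 0 -> cos (carg z) = complex.Re z / normc z.
Proof.
move=> z0; rewrite /carg /cabs /=; case: ifP => _; rewrite ?cosN acosK//;
  by rewrite in_itv /= Re_div_normc.
Qed.

Lemma sin_carg z : z != 0 -> sin (carg z) = complex.Im z / normc z.
Proof.
move=> z0; have zp := z0; rewrite -normc_gt0 in zp.
have e : Num.sqrt (1 - (complex.Re z / normc z) ^+ 2) =
    `|complex.Im z| / normc z.
  rewrite -[in RHS](ger0_norm (normc_ge0 z)) -normrV ?unitfE ?gt_eqF//.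
  rewrite -normrM -sqrtr_sqr; congr Num.sqrt.
  have := sqr_normcE z; rewrite !exprMn exprVn.
  have n0 : normc z ^+ 2 != 0 by rewrite expf_neq0 ?gt_eqF.
  move=> h; apply: (mulIf n0); rewrite mulrBl !mulfVK// mul1r h; ring.
rewrite /carg /cabs /=; case: ifP => Iz;
  rewrite ?sinN sin_acos ?Re_div_normc// e.
  by rewrite ger0_norm.
by rewrite ltr0_norm ?mulNr ?opprK// ltNge Iz.
Qed.

Lemma clnK z : z != 0 -> cexp (cln z) = z.
Proof.
move=> z0; rewrite /cexp /= cos_carg// sin_carg//; rewrite -normc_gt0 in z0.
rewrite lnK ?posrE// !mulrA ![normc z * _]mulrC !mulfK ?gt_eqF//.
by case: (z).
Qed.

Lemma cexpK w : - pi < complex.Im w <= pi -> cln (cexp w) = w.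
Proof.
case: w => a b /= /andP[b1 b2]; rewrite /cln /cabs -[X in ln X]/(normc _).
rewrite normc_cexp /= expRK; congr Complex.
rewrite /carg /cabs -[complex.Re `|_|]/(normc _) normc_cexp /=.
rewrite mulrAC mulfV ?gt_eqF ?expR_gt0// mul1r pmulr_rge0 ?expR_gt0//.
have [b0|b0] := leP 0 b.
  by rewrite sin_ge0_pi ?b0//= cosK// in_itv /= b0.
rewrite ifF; first by rewrite cosKN ?opprK// !ltW.
apply/negbTE; rewrite -ltNge -oppr_gt0 -sinN sin_gt0_pi//.
by rewrite oppr_gt0 b0 ltrNl.
Qed.

(** The cosine of the argument is positive here. As a result, the difference of two such arguments
    stays in ]-pi, pi[. *)
Lemma carg_lt_pihalf z : 0 < complex.Re z -> `|carg z| < pi / 2.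
Proof.
move=> z0; have zn0 : z != 0.
  by apply: contraTneq z0 => ->; rewrite ltxx.
have p : 0 < complex.Re z / normc z by rewrite divr_gt0 ?normc_gt0.
have h : `|carg z| = acos (complex.Re z / normc z).
  rewrite /carg /cabs; case: ifP => _; rewrite ?normrN ger0_norm//;
  by rewrite acos_ge0 ?Re_div_normc.
have /andP[p1 p2] := Re_div_normc zn0.
have a0 : 0 <= acos (complex.Re z / normc z) by rewrite acos_ge0 ?Re_div_normc.
have a1 := acos_lepi (Re_div_normc zn0).
rewrite h -ltr_cos ?in_itv /= ?a0 ?a1//.
  by rewrite cos_pihalf acosK// in_itv /= p1 p2.
by have := pi_ge0 R => ?; apply/andP; split; lra.
Qed.

Lemma cln1 : cln (1 : C) = 0.
Proof.
rewrite -cexp0 cexpK//= oppr_lt0 pi_gt0 pi_ge0//.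
Qed.

(** The function L, in the form that makes the kernel equal to [1 + clnV1B (cdot z w)] by
    computation. *)
Definition clnV1B x : C := cln (1 / (1 - x)).

Lemma clnV1B0 : clnV1B 0 = 0.
Proof. by rewrite /clnV1B subr0 divr1 cln1. Qed.

Lemma sub1_neq0 x : normc x < 1 -> 1 - x != 0.
Proof.
move=> x1; rewrite subr_eq0; apply: contraTneq x1 => <-.
by rewrite normc1 ltxx.
Qed.

Lemma Re_invc_gt0 z : 0 < complex.Re z -> 0 < complex.Re z^-1.
Proof.
by case: z => a b /= a0; rewrite divr_gt0// ltr_pwDl ?exprn_gt0// sqr_ge0.
Qed.

Lemma Re_sub1_gt0 x : normc x < 1 -> 0 < complex.Re (1 - x).
Proof.
move=> x1; have := Re_le_normc x; have := ler_norm (complex.Re x).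
by case: x x1 => a b /=; lra.
Qed.

Lemma cexp_clnV1B x : x != 1 -> cexp (clnV1B x) = (1 - x)^-1.
Proof.
move=> x1; rewrite /clnV1B div1r clnK// invr_eq0 subr_eq0 eq_sym//.
Qed.

Lemma normc_lt1_neq1 x : normc x < 1 -> x != 1.
Proof. by apply: contraTneq => ->; rewrite normc1 ltxx. Qed.

Lemma Im_clnV1B x : normc x < 1 -> `|complex.Im (clnV1B x)| < pi / 2.
Proof.
by move=> x1; rewrite carg_lt_pihalf// div1r Re_invc_gt0 ?Re_sub1_gt0.
Qed.

(** Exponentials agree because 1 - h / (1 - s) = (1 - (s + h)) / (1 - s). No multiple of 2 pi i
    appears, since L(s + h) and L(s) have imaginary parts below pi / 2 in absolute value. *)
Lemma clnV1B_add s h : normc s < 1 -> normc (s + h) < 1 ->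
  clnV1B (s + h) = clnV1B s + clnV1B (h / (1 - s)).
Proof.
move=> s1 sh1.
suff -> : clnV1B (h / (1 - s)) = clnV1B (s + h) - clnV1B s.
  by rewrite [RHS]addrC subrK.
rewrite {1}/clnV1B -(@cexpK (clnV1B (s + h) - clnV1B s)).
  congr cln; rewrite cexpD cexpN !cexp_clnV1B ?normc_lt1_neq1// invrK div1r.
  have s0 := sub1_neq0 s1; have sh0 := sub1_neq0 sh1.
  have -> : 1 - h / (1 - s) = (1 - (s + h)) / (1 - s).
    by apply: (mulIf s0); rewrite mulrBl !mulfVK// mul1r; ring.
  by rewrite invf_div mulrC.
have := Im_clnV1B s1; have := Im_clnV1B sh1.
move: (clnV1B _) (clnV1B s) => [a b] [c d] /=.
by rewrite !ltr_norml => /andP[? ?] /andP[? ?]; apply/andP; split; lra.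
Qed.

Lemma clnV1B_inj x y :
  normc x < 1 -> normc y < 1 -> clnV1B x = clnV1B y -> x = y.
Proof.
move=> x1 y1 /(congr1 cexp); rewrite !cexp_clnV1B ?normc_lt1_neq1//.
move=> /invr_inj.
by move=> /addrI /oppr_inj.
Qed.

Lemma cexp_conj w : cexp w^* = (cexp w)^*.
Proof. by case: w => a b; rewrite /cexp /= cosN sinN mulrN. Qed.

Lemma clnV1B_conj x : normc x < 1 -> clnV1B x^* = (clnV1B x)^*.
Proof.
move=> x1; rewrite {1}/clnV1B -(@cexpK (clnV1B x)^*).
  rewrite cexp_conj cexp_clnV1B ?normc_lt1_neq1// div1r; congr cln.
  by rewrite conjc_inv rmorphB rmorph1.
have := Im_clnV1B x1; have := pi_gt0 R; move: (clnV1B _) => [a b] /=.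
by rewrite !ltr_norml => ? /andP[? ?]; apply/andP; split; lra.
Qed.

(** If L(x) = -1, then |1 - x| = e >= 2, whereas |1 - x| < 2. This allows division by P. *)
Lemma add1_clnV1B_neq0 x : normc x < 1 -> 1 + clnV1B x != 0.
Proof.
move=> x1; apply/eqP => /eqP; rewrite addrC addr_eq0 => /eqP h.
have := cexp_clnV1B (normc_lt1_neq1 x1); rewrite h => /(congr1 (@normc R)).
rewrite normcV normc_cexp /= expRN => /invr_inj e.
have := le_normcD 1 (- x); rewrite normcN normc1 -e.
have := expR_ge1Dx (1 : R); lra.
Qed.

(** Real and imaginary parts are regrouped into the real remainders above. The constant is 4 + 4 + 2
    from the real part plus 4 + 4 from the imaginary part. *)
Lemma normc_cexp_taylor2_le w : normc w <= 1 ->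
  normc (cexp w - 1 - w - w ^+ 2 / 2) <= 18 * normc w ^+ 3.
Proof.
move=> w1; apply: (le_trans (normc_le_ReIm _)).
have n0 := normc_ge0 w; case: w w1 n0 => a b.
have an : `|a| <= normc (a +i* b) := Re_le_normc (a +i* b).
have bn : `|b| <= normc (a +i* b) := Im_le_normc (a +i* b).
move: (normc _) an bn => n an bn n1 n0.
have -> : complex.Re (cexp (a +i* b) - 1 - (a +i* b) - (a +i* b) ^+ 2 / 2) =
   (expR a - 1 - a - a ^+ 2 / 2) + expR a * (cos b - 1 + b ^+ 2 / 2)
   - (expR a - 1) * (b ^+ 2 / 2).
  rewrite (_ : (a +i* b) ^+ 2 / 2 = ((a ^+ 2 - b ^+ 2) / 2) +i* (a * b)).
    by rewrite /=; field.
  apply: (@mulIf _ (2 : C)); first by rewrite pnatr_eq0.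
  rewrite mulfVK ?pnatr_eq0// expr2; apply/eqP.
  by rewrite eq_complex /=; apply/andP; split; apply/eqP; field.
have -> : complex.Im (cexp (a +i* b) - 1 - (a +i* b) - (a +i* b) ^+ 2 / 2) =
   expR a * (sin b - b) + (expR a - 1 - a) * b.
  rewrite (_ : (a +i* b) ^+ 2 / 2 = ((a ^+ 2 - b ^+ 2) / 2) +i* (a * b)).
    by rewrite /=; field.
  apply: (@mulIf _ (2 : C)); first by rewrite pnatr_eq0.
  rewrite mulfVK ?pnatr_eq0// expr2; apply/eqP.
  by rewrite eq_complex /=; apply/andP; split; apply/eqP; field.
have a1 : `|a| <= 1 by exact: le_trans n1.
have b1 : `|b| <= 1 by exact: le_trans n1.
have ea : `|expR a| <= 4.
  rewrite ger0_norm ?expR_ge0 ?expR_le4// (le_trans (ler_norm _))//.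
have e1 := expR_taylor2_le a1.
have e2 := cos_taylor2_le b.
have e3 := expR_sub1_le a1.
have e4 := sin_subx_le b.
have e5 := expR_sub1x_le a1.
have p3 : `|a| ^+ 3 <= n ^+ 3 by rewrite lerXn2r ?nnegrE.
have q3 : `|b| ^+ 3 <= n ^+ 3 by rewrite lerXn2r ?nnegrE.
have q4 : `|b| ^+ 4 <= n ^+ 3.
  by rewrite exprSr -[leRHS]mulr1 ler_pM ?exprn_ge0.
have ab : `|a| * `|b| ^+ 2 <= n ^+ 3.
  by rewrite [leRHS]exprS ler_pM ?exprn_ge0 ?lerXn2r ?nnegrE.
have ba : `|a| ^+ 2 * `|b| <= n ^+ 3.
  by rewrite [leRHS]exprSr ler_pM ?exprn_ge0 ?lerXn2r ?nnegrE.
have t1 : `|expR a * (cos b - 1 + b ^+ 2 / 2)| <= 4 * n ^+ 3.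
  by rewrite normrM ler_pM// (le_trans e2).
have t2 : `|(expR a - 1) * (b ^+ 2 / 2)| <= 2 * n ^+ 3.
  rewrite [leLHS]normrM [X in _ * X]normrM normfV normrX (ger0_norm (ler0n _ 2)).
  apply: (@le_trans _ _ (4 * `|a| * (`|b| ^+ 2 / 2))); last by lra.
  by rewrite ler_wpM2r// divr_ge0// exprn_ge0.
have t3 : `|expR a * (sin b - b)| <= 4 * n ^+ 3.
  by rewrite normrM ler_pM// (le_trans e4).
have t4 : `|(expR a - 1 - a) * b| <= 4 * n ^+ 3.
  rewrite normrM; apply: (@le_trans _ _ (4 * `|a| ^+ 2 * `|b|)); last by lra.
  by rewrite ler_wpM2r.
apply: (le_trans (lerD (le_trans (ler_normB _ _)
  (lerD (ler_normD _ _) (lexx _))) (ler_normD _ _))).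
lra.
Qed.

End ComplexLog.

(** * Limits at 0 and asymptotics of the logarithm *)
Section PuncturedLimits.
Variable K : numFieldType.
Implicit Types (f g : K -> K) (P : K -> Prop).

(* Spelled out without the topological structures of [K], which unify badly
   when [K] is [R[i]]. *)
Definition near0 P : Prop :=
  exists2 d : K, 0 < d & forall t, t != 0 -> `|t| < d -> P t.

Definition cvg0 f (l : K) : Prop :=
  forall e : K, 0 < e -> near0 (fun t => `|l - f t| < e).

Lemma near0P P : near0 P <-> \forall t \near (0 : K)^', P t.
Proof.
split=> [[d d0 dP]|].
- apply/nbhs_ballP; exists d => //= t.
  by rewrite /ball /= sub0r normrN => td t0; exact: dP.
- move=> /nbhs_ballP[d /= d0 dP]; exists d => // t t0 td; apply: dP => //.
  by rewrite /ball /= sub0r normrN.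
Qed.

Lemma cvg0P f l : cvg0 f l <-> f t @[t --> (0 : K)^'] --> l.
Proof.
split=> [fl|/cvgrPdist_lt fl e /fl /near0P//].
by apply/cvgrPdist_lt => e /fl /near0P.
Qed.

Lemma near0_neq0 : near0 (fun t => t != 0).
Proof. by exists 1 => //; exact: ltr01. Qed.

Lemma near0W P Q : (forall t, P t -> Q t) -> near0 P -> near0 Q.
Proof. by move=> PQ [d d0 dP]; exists d => // t t0 /(dP t t0) /PQ. Qed.

Lemma near0I P Q : near0 P -> near0 Q -> near0 (fun t => P t /\ Q t).
Proof.
move=> /near0P hP /near0P hQ; apply/near0P; near=> t; split.
- by near: t.
- by near: t.
Unshelve. all: by end_near. Qed.

Lemma cvg0_eq f g l : near0 (fun t => f t = g t) -> cvg0 f l -> cvg0 g l.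
Proof.
move=> fg fl e /fl h; apply: (near0W _ (near0I fg h)).
by move=> t [->].
Qed.

Lemma cvg0_unique f a b : cvg0 f a -> cvg0 f b -> a = b.
Proof.
by move=> /cvg0P fa /cvg0P fb; apply: cvg_unique fa fb; exact: norm_hausdorff.
Qed.

Lemma cvg0_cst (a : K) : cvg0 (fun=> a) a.
Proof. by apply/cvg0P; exact: cvg_cst. Qed.

Lemma cvg0_id : cvg0 id 0.
Proof. by move=> e e0; exists e => // t _; rewrite sub0r normrN. Qed.

Lemma cvg0D f g a b : cvg0 f a -> cvg0 g b -> cvg0 (fun t => f t + g t) (a + b).
Proof. by move=> /cvg0P fa /cvg0P gb; apply/cvg0P; exact: cvgD. Qed.

Lemma cvg0B f g a b : cvg0 f a -> cvg0 g b -> cvg0 (fun t => f t - g t) (a - b).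
Proof. by move=> /cvg0P fa /cvg0P gb; apply/cvg0P; exact: cvgB. Qed.

Lemma cvg0M f g a b : cvg0 f a -> cvg0 g b -> cvg0 (fun t => f t * g t) (a * b).
Proof. by move=> /cvg0P fa /cvg0P gb; apply/cvg0P; exact: cvgM. Qed.

Lemma cvg0V f a : a != 0 -> cvg0 f a -> cvg0 (fun t => (f t)^-1) a^-1.
Proof. by move=> a0 /cvg0P fa; apply/cvg0P; exact: cvgV. Qed.

Lemma cvg0_sum (I : Type) (r : seq I) (F : I -> K -> K) (l : I -> K) :
  (forall i, cvg0 (F i) (l i)) ->
  cvg0 (fun t => \sum_(i <- r) F i t) (\sum_(i <- r) l i).
Proof.
move=> Fl; elim: r => [|i r IH].
  rewrite big_nil; apply: cvg0_eq (cvg0_cst 0); exists 1 => // t _ _.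
  by rewrite big_nil.
rewrite big_cons; apply: cvg0_eq (cvg0D (Fl i) IH); exists 1 => // t _ _.
by rewrite big_cons.
Qed.

Lemma cvg0_linear a : cvg0 ( *%R^~ a) 0.
Proof.
by rewrite -(mul0r a); apply: cvg0M; [exact: cvg0_id|exact: cvg0_cst].
Qed.

Lemma cvg0_slope a : cvg0 (fun t => t^-1 * (t * a)) a.
Proof.
apply: cvg0_eq (cvg0_cst a); apply: near0W near0_neq0 => t t0.
by rewrite mulrA mulVf ?mul1r.
Qed.

Lemma cvg0_slope_cvg f l : cvg0 (fun t => t^-1 * f t) l -> cvg0 f 0.
Proof.
move=> fl; rewrite -(mul0r l); apply: cvg0_eq (cvg0M cvg0_id fl).
by apply: near0W near0_neq0 => t t0; rewrite mulrA mulfV ?mul1r.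
Qed.

Lemma near0_cvg_neq0 f l : l != 0 -> cvg0 f l -> near0 (fun t => f t != 0).
Proof.
move=> l0 fl; have l0' : 0 < `|l| by rewrite normr_gt0.
apply: near0W (fl _ l0') => t; apply: contraTneq => ->.
by rewrite subr0 ltxx.
Qed.

End PuncturedLimits.

(** * Second-order expansion of L at 0 *)

Section LogTaylor.
Variable R : realType.
Local Notation C := R[i].
Implicit Types x y z v w s h : C.

(** A crude bound that brings L(x) into the unit disc, where the Taylor estimate for [cexp] applies.
    The real part is -ln |1 - x|, bounded through e^u >= 1 + u for both signs of u. *)
Lemma normc_clnV1B_le x : normc x <= 6^-1 -> normc (clnV1B x) <= 5 * normc x.
Proof.
move=> x6; have x1 : normc x < 1 by lra.
have xn1 := normc_lt1_neq1 x1.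
have n0 := normc_ge0 x; have r0 := normc_ge0 (1 - x).
have r1 : normc (1 - x) <= 1 + normc x.
  by rewrite (le_trans (le_normcD _ _))// normcN normc1.
have r2 : 1 - normc x <= normc (1 - x).
  have := le_normcD (1 - x) x; rewrite subrK normc1; lra.
have rp : 0 < normc (1 - x) by lra.
have rV : (normc (1 - x))^-1 <= 1 + 2 * normc x.
  rewrite -div1r ler_pdivrMr//; nra.
have e : expR (complex.Re (clnV1B x)) = (normc (1 - x))^-1.
  by rewrite -normc_cexp cexp_clnV1B// normcV.
have hRe : `|complex.Re (clnV1B x)| <= 2 * normc x.
  have := expR_ge1Dx (complex.Re (clnV1B x)).
  have := expR_ge1Dx (- complex.Re (clnV1B x)).
  rewrite expRN e invrK ler_norml => *; apply/andP; split; lra.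
have hIm : `|complex.Im (clnV1B x)| <= 3 * normc x.
  (* Let n = |x|. If |Im L(x)| > 3n, monotonicity of the sine gives sin(3n) < |sin(Im L(x))| <= (1 +
     2n) n. This contradicts sin(3n) >= 3n - 27 n^3 for n <= 1/6. *)
  rewrite leNgt; apply/negP => h.
  have hpi := Im_clnV1B x1; have pi2 := pi_ge2 R.
  have s1 : sin (3 * normc x) < sin `|complex.Im (clnV1B x)|.
    by rewrite ltr_sin// in_itv /=; apply/andP; split; lra.
  have s2 : `|sin (complex.Im (clnV1B x))| <= (1 + 2 * normc x) * normc x.
    rewrite /= div1r sin_carg ?invr_eq0 ?sub1_neq0// normcV invrK.
    have := cexp_clnV1B xn1; rewrite normrM (ger0_norm r0) => _.
    have -> : `|complex.Im (1 - x)^-1| = `|complex.Im x| / normc (1 - x) ^+ 2.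
      have -> : `|complex.Im x| = `|complex.Im (1 - x)|.
        by case: (x) => a b /=; rewrite sub0r normrN.
      rewrite sqr_normcE; case: (1 - x) => a b /=.
      by rewrite normrN normrM normfV [X in _ / X]ger0_norm ?addr_ge0 ?sqr_ge0.
    rewrite expr2 invfM mulrA mulfVK ?gt_eqF// mulrC ler_pM ?invr_ge0//.
    exact: Im_le_normc.
  have s3 : sin `|complex.Im (clnV1B x)| <= `|sin (complex.Im (clnV1B x))|.
    case: (ger0P (complex.Im (clnV1B x))) => _; first exact: ler_norm.
    by rewrite sinN -normrN ler_norm.
  have := sin_subx_le (3 * normc x); rewrite ler_norml => /andP[+ _].
  rewrite ger0_norm ?mulr_ge0//; move: (sin (3 * _)) s1 => t s1.
  move: (normc x) n0 x6 s2 => n n0 n6 s2 s4.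
  have : n ^+ 2 <= 36^-1 by rewrite expr2; nra.
  by move: s4; rewrite (_ : (3 * n) ^+ 3 = 27 * (n * n ^+ 2)); [nra|ring].
apply: (le_trans (normc_le_ReIm _)); lra.
Qed.

(** With w = L(x), expanding 1 - x = e^(-w) gives w - x - w^2 / 2 = O(w^3). Replacing w^2 by x^2
    then costs (w - x)(w + x) / 2, also of order 3. *)
Lemma clnV1B_taylor2_le x : normc x <= 6^-1 ->
  normc (clnV1B x - x - x ^+ 2 / 2) <= 10 ^+ 4 * normc x ^+ 3.
Proof.
move=> x6; have n0 := normc_ge0 x; have h := normc_clnV1B_le x6.
have w0 := normc_ge0 (clnV1B x).
have x1 : normc x < 1 by lra.
have w1 : normc (- clnV1B x) <= 1 by rewrite normcN; lra.
have t := normc_cexp_taylor2_le w1.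
rewrite cexpN cexp_clnV1B ?normc_lt1_neq1// invrK normcN sqrrN opprK in t.
set w := clnV1B x in h w0 w1 t *.
have e1 : 1 - x - 1 + w - w ^+ 2 / 2 = w - x - w ^+ 2 / 2 by ring.
rewrite e1 in t.
have sq y : normc (y ^+ 2 / 2) = normc y ^+ 2 / 2.
  by rewrite normcM normcV normc2 expr2 normcM -expr2.
have t2 : normc (w - x) <= normc (w ^+ 2 / 2) + 18 * normc w ^+ 3.
  rewrite -[w - x](subrK (w ^+ 2 / 2)) addrC.
  by rewrite (le_trans (le_normcD _ _))// lerD2l.
have e2 : w - x - x ^+ 2 / 2 = w - x - w ^+ 2 / 2 + (w - x) * (w + x) / 2.
  by ring.
rewrite {}e2; apply: (le_trans (le_normcD _ _)).
rewrite !normcM normcV normc2.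
have t3 : normc (w + x) <= 6 * normc x.
  by apply: (le_trans (le_normcD _ _)); lra.
rewrite sq in t2.
have t4 := normc_ge0 (w - x).
move: (normc w) (normc x) (normc (w - x - _)) (normc (w - x)) (normc (w + x))
  n0 w0 h x6 t t2 t3 t4 => a n p q r n0 a0 h n6 t t2 t3 t4.
(* The cubic remainder contributes 18 * 125 = 2250 and the correction 2300 * 6 / 2 = 6900, in total
   less than 10^4. *)
have a2 : a ^+ 2 <= 25 * n ^+ 2 by nra.
have a3 : a ^+ 3 <= 125 * n ^+ 3.
  rewrite [leLHS]exprS (le_trans (ler_pM _ (sqr_ge0 _) h a2))//.
  by rewrite [n ^+ 3]exprS; lra.
have n3 : n ^+ 3 <= n ^+ 2.
  by rewrite [leLHS]exprS -[leRHS]mul1r ler_wpM2r ?exprn_ge0//; lra.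
have q2 : q <= 2300 * n ^+ 2 by lra.
have qr : q * r <= 13800 * n ^+ 3 by rewrite exprS; nra.
have e4 : (10 : R) ^+ 4 = 10000 by ring.
by have : 0 <= n ^+ 3; [rewrite exprn_ge0|rewrite e4; lra].
Qed.

(** The value at 0 is the limit, so composing with a function that vanishes at some points raises no
    case distinction in limits. *)
Definition clnV1B_rem x : C := if x == 0 then 2^-1 else (clnV1B x - x) / x ^+ 2.

Lemma clnV1B_remE x : clnV1B x = x + x ^+ 2 * clnV1B_rem x.
Proof.
rewrite /clnV1B_rem; case: eqP => [->|/eqP x0].
  by rewrite clnV1B0 expr0n mul0r addr0.
by rewrite mulrC mulfVK ?expf_neq0// addrC subrK.
Qed.

Lemma cvg0_clnV1B_rem (f : C -> C) : cvg0 f 0 -> cvg0 (clnV1B_rem \o f) 2^-1.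
Proof.
move=> f0 e e0.
(* One radius for the Taylor estimate to apply, the other to make 10^4 |x| smaller than [e]. *)
have h1 : 0 < (6^-1 : R)%:C by rewrite ltcR.
have h2 : 0 < e / 10 ^+ 4 by rewrite divr_gt0 ?exprn_gt0.
apply: near0W (near0I (f0 _ h1) (f0 _ h2)) => t; rewrite !sub0r !normrN /=.
move: (f t) => x [x6 xe]; rewrite /clnV1B_rem; case: eqP => [_|/eqP x0].
  by rewrite subrr normr0.
have -> : 2^-1 - (clnV1B x - x) / x ^+ 2 = - (clnV1B x - x - x ^+ 2 / 2) / x ^+ 2.
  apply: (mulIf (expf_neq0 2 x0)); rewrite mulrBl !mulfVK ?expf_neq0//; ring.
have b : `|clnV1B x - x - x ^+ 2 / 2| <= 10 ^+ 4 * `|x| ^+ 3.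
  have := clnV1B_taylor2_le (x := x); rewrite -!lecR rmorphM !rmorphXn rmorph_nat.
  by apply; exact: ltW.
rewrite normrM normrN normfV normrX ltr_pdivrMr ?exprn_gt0 ?normr_gt0//.
apply: (le_lt_trans b); rewrite [`|x| ^+ 3]exprS mulrA.
rewrite ltr_pM2r ?exprn_gt0 ?normr_gt0//.
by rewrite mulrC -ltr_pdivlMr ?exprn_gt0.
Qed.

End LogTaylor.

(** * First- and second-order terms of the kernel identity *)

Section LogLimits.
Variable R : realType.
Local Notation C := R[i].
Implicit Types (f h : C -> C).

Lemma cvg0_clnV1B_slope f (l : C) :
  cvg0 (fun t => t^-1 * f t) l -> cvg0 (fun t => t^-1 * clnV1B (f t)) l.
Proof.
move=> fl; have f0 := cvg0_slope_cvg fl.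
have := cvg0M fl (cvg0D (cvg0_cst 1) (cvg0M f0 (cvg0_clnV1B_rem f0))).
rewrite mul0r addr0 mulr1; apply: cvg0_eq; exists 1 => // t _ _ /=.
by rewrite [in RHS]clnV1B_remE; ring.
Qed.

Lemma cvg0_add1_clnV1B f : cvg0 f 0 -> cvg0 (fun t => 1 + clnV1B (f t)) 1.
Proof.
move=> f0; have := cvg0D (cvg0_cst 1)
  (cvg0D f0 (cvg0M (cvg0M f0 f0) (cvg0_clnV1B_rem f0))).
rewrite !mul0r !addr0; apply: cvg0_eq; exists 1 => // t _ _ /=.
by rewrite [in RHS]clnV1B_remE expr2.
Qed.

(** By [clnV1B_add], P(s + h) = P(s) + L(h / (1 - s)). Subtracting P(s) from both sides, dividing by
    t and letting t tend to 0 leaves P(s) p = al P(s) + be / (1 - s). *)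
Lemma log_identity_order1 (s al p be : C) h : normc s < 1 ->
  cvg0 (fun t => t^-1 * h t) be ->
  near0 (fun t => normc (s + h t) < 1 /\
    (1 + clnV1B s) * (1 + clnV1B (t * p)) =
    (1 + clnV1B (t * al)) * (1 + clnV1B (s + h t))) ->
  (1 + clnV1B s) * (p - al) = be / (1 - s).
Proof.
move=> s1 hb E.
have L3 : cvg0 (fun t => t^-1 * clnV1B (h t / (1 - s))) (be / (1 - s)).
  apply: cvg0_clnV1B_slope; apply: cvg0_eq (cvg0M hb (cvg0_cst (1 - s)^-1)).
  by exists 1 => // t _ _; rewrite mulrA.
have A1 := cvg0M (cvg0_cst (1 + clnV1B s)) (cvg0_clnV1B_slope (cvg0_slope p)).
have A2 := cvg0D (cvg0M (cvg0_clnV1B_slope (cvg0_slope al)) (cvg0_cst (1 + clnV1B s)))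
  (cvg0M (cvg0_add1_clnV1B (cvg0_linear al)) L3).
have e : (1 + clnV1B s) * p = al * (1 + clnV1B s) + 1 * (be / (1 - s)).
  apply: cvg0_unique A1 _; apply: cvg0_eq A2.
  apply: near0W E => t [h1 e]; rewrite clnV1B_add// in e.
  move: (clnV1B s) (clnV1B (t * p)) (clnV1B (t * al)) (clnV1B (h t / (1 - s))) (t^-1) e.
  move=> S X Y Z i e.
  rewrite -[RHS](_ : i * ((1 + S) * (1 + X) - (1 + S)) = _); last by ring.
  by rewrite e; ring.
by rewrite mulrBr e mul1r; ring.
Qed.

(* The terms of order 1 in [t] give [b = b'].  Then those of order 2 amount
   to [b ^+ 2 / (1 + clnV1B s) = b ^+ 2]. *)
Lemma log_identity_order2 (s al b b' : C) : normc s < 1 ->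
  near0 (fun t =>
    (1 + clnV1B s) * clnV1B (t * b / ((1 - s) * (1 - t * al) * (1 + clnV1B s))) =
    (1 + clnV1B (t * al)) *
      clnV1B (t * b' / ((1 - s) * (1 - t * al) * (1 + clnV1B (t * al))))) ->
  b = b' /\ (b != 0 -> s = 0).
Proof.
move=> s1 E; have Ps := add1_clnV1B_neq0 s1; have s0 := sub1_neq0 s1.
have LP := cvg0_add1_clnV1B (cvg0_linear al).
have L1 : cvg0 (fun t => 1 - t * al) 1.
  by have := cvg0B (cvg0_cst 1) (cvg0_linear al); rewrite subr0.
have LQ (g : C -> C) (c x : C) : c != 0 -> cvg0 g c ->
    cvg0 (fun t => t^-1 * (t * x / ((1 - s) * (1 - t * al) * g t)))
      (x / ((1 - s) * c)).
  move=> c0 gc.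
  have := cvg0M (cvg0_cst x)
    (cvg0V _ (cvg0M (cvg0M (cvg0_cst (1 - s)) L1) gc)).
  rewrite mulr1 mulf_neq0// => /(_ isT); apply: cvg0_eq.
  apply: near0W (near0_neq0 C) => t t0.
  by rewrite -[in RHS]mulrA [RHS]mulrA mulVf// mul1r.
have LS (x : C) := LQ _ _ x Ps (cvg0_cst _).
have LT (x : C) := LQ _ _ x (oner_neq0 _) LP.
have bb' : b = b'.
  have A1 := cvg0M (cvg0_cst (1 + clnV1B s)) (cvg0_clnV1B_slope (LS b)).
  have A2 := cvg0M LP (cvg0_clnV1B_slope (LT b')).
  have : (1 + clnV1B s) * (b / ((1 - s) * (1 + clnV1B s))) = 1 * (b' / ((1 - s) * 1)).
    apply: cvg0_unique A1 _; apply: cvg0_eq A2; apply: near0W E => t e.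
    by rewrite mulrCA -e mulrCA.
  have -> : (1 + clnV1B s) * (b / ((1 - s) * (1 + clnV1B s))) = b / (1 - s).
    by field; rewrite s0 Ps.
  by rewrite mul1r mulr1 => /(mulIf _); apply; rewrite invr_eq0.
split=> // b0; rewrite -{}bb' in E.
have R1 := cvg0M (cvg0_clnV1B_rem (cvg0_slope_cvg (LS b)))
  (cvg0_cst (1 + clnV1B s)^-1).
have R2 := cvg0M (cvg0_clnV1B_rem (cvg0_slope_cvg (LT b)))
  (cvg0V (oner_neq0 _) LP).
have : 2^-1 / (1 + clnV1B s) = 2^-1 / 1 :> C.
  apply: cvg0_unique R1 _; apply: cvg0_eq R2.
  have Q0 := near0_cvg_neq0 (oner_neq0 _) LP.
  have T0 := near0_cvg_neq0 (oner_neq0 _) L1.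
  apply: near0W (near0I E (near0I (near0I Q0 T0) (near0_neq0 C))).
  move=> t [e [[q0 p0] t0]] /=.
  set u := t * b / (_ * _ * (1 + clnV1B s)) in e *.
  set v := t * b / (_ * _ * (1 + clnV1B (t * al))) in e *.
  (* The equation reads P L(y / P) = Q L(y / Q). The terms y cancel, and dividing by y^2 compares
     the two remainders, whose limits are known. *)
  pose y := t * b / ((1 - s) * (1 - t * al)).
  have y0 : y != 0 by rewrite /y !(mulf_neq0, invr_eq0).
  have uE : u = y / (1 + clnV1B s) by rewrite /u /y; field; rewrite s0 p0 Ps.
  have vE : v = y / (1 + clnV1B (t * al)) by rewrite /v /y; field; rewrite s0 p0 q0.
  move: e; rewrite (clnV1B_remE u) (clnV1B_remE v).
  move: (clnV1B_rem u) (clnV1B_rem v) => ru rv; rewrite uE vE.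
  move: (1 + clnV1B s) (1 + clnV1B (t * al)) Ps q0 => P Q P0 Q0' e.
  apply: (mulfI (expf_neq0 2 y0)); apply: (addrI y).
  have -> : y + y ^+ 2 * (rv * Q^-1) = Q * (y / Q + (y / Q) ^+ 2 * rv).
    by field.
  by rewrite -e; field.
have n0 : (2^-1 : C) != 0 by rewrite invr_eq0 pnatr_eq0.
move=> /(mulfI n0) /invr_inj; rewrite -[RHS]addr0 => /addrI e.
apply: clnV1B_inj; rewrite ?clnV1B0//.
by rewrite normc0.
Qed.

End LogLimits.

(** * Orthogonal projection in Hilbert spaces *)
Section InnerProduct.
Variables (R : realType) (V : lmodType R[i]).
Local Notation C := R[i].
Variables (D : set V) (ip : V -> V -> C).
Implicit Types f g h : V.

(** Completeness is left out of [hilbert_space], so that the same lemmas serve [cdot] on the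
    Euclidean space. *)
Record inner_product : Prop := InnerProduct {
  inner0 : D 0;
  inner_lin : forall (a : C) f g, D f -> D g -> D (a *: f + g);
  inner_linl : forall (a : C) f g h, D f -> D g -> D h ->
    ip (a *: f + g) h = a * ip f h + ip g h;
  inner_conj : forall f g, D f -> D g -> ip g f = (ip f g)^*;
  inner_pos : forall f, D f -> f != 0 -> 0 < ip f f }.

End InnerProduct.

Section InnerProductTheory.
Variables (R : realType) (V : lmodType R[i]).
Local Notation C := R[i].
Variables (D : set V) (ip : V -> V -> C).
Implicit Types f g h : V.
Local Notation norm := (hnorm ip).

Lemma innerZ (a : C) f : inner_product D ip -> D f -> D (a *: f).
Proof.
by move=> H Df; rewrite -[_ *: _]addr0; apply: (inner_lin H) Df (inner0 H).
Qed.

Lemma innerD f g : inner_product D ip -> D f -> D g -> D (f + g).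
Proof. by move=> H Df Dg; have := inner_lin H 1 Df Dg; rewrite scale1r. Qed.

Lemma innerN f : inner_product D ip -> D f -> D (- f).
Proof. by move=> H Df; rewrite -scaleN1r; exact: innerZ. Qed.

Lemma innerB f g : inner_product D ip -> D f -> D g -> D (f - g).
Proof. by move=> H Df Dg; apply: innerD => //; exact: innerN. Qed.

Lemma ip0l h : inner_product D ip -> D h -> ip 0 h = 0.
Proof.
move=> H Dh; have := inner_linl H 1 (inner0 H) (inner0 H) Dh.
by rewrite scaler0 addr0 mul1r -{1}[ip 0 h]addr0 => /addrI.
Qed.

Lemma ipZl a f h : inner_product D ip -> D f -> D h ->
  ip (a *: f) h = a * ip f h.
Proof.
move=> H Df Dh; have := inner_linl H a Df (inner0 H) Dh.
by rewrite !addr0 ip0l// addr0.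
Qed.

Lemma ipDl f g h : inner_product D ip -> D f -> D g -> D h ->
  ip (f + g) h = ip f h + ip g h.
Proof.
by move=> H Df Dg Dh; have := inner_linl H 1 Df Dg Dh; rewrite scale1r mul1r.
Qed.

Lemma ipNl f h : inner_product D ip -> D f -> D h -> ip (- f) h = - ip f h.
Proof. by move=> H Df Dh; rewrite -scaleN1r ipZl// mulN1r. Qed.

Lemma ipBl f g h : inner_product D ip -> D f -> D g -> D h ->
  ip (f - g) h = ip f h - ip g h.
Proof. by move=> H Df Dg Dh; rewrite ipDl ?ipNl//; exact: innerN. Qed.

Lemma ipBr f g h : inner_product D ip -> D f -> D g -> D h ->
  ip h (f - g) = ip h f - ip h g.
Proof.
move=> H Df Dg Dh; rewrite (inner_conj H (innerB H Df Dg) Dh) ipBl//.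
by rewrite rmorphB /= -!(inner_conj H).
Qed.

Lemma ipDr f g h : inner_product D ip -> D f -> D g -> D h ->
  ip h (f + g) = ip h f + ip h g.
Proof.
move=> H Df Dg Dh; rewrite (inner_conj H (innerD H Df Dg) Dh) ipDl//.
by rewrite rmorphD /= -!(inner_conj H).
Qed.

Lemma ipZr a f h : inner_product D ip -> D f -> D h ->
  ip h (a *: f) = a^* * ip h f.
Proof.
move=> H Df Dh; rewrite (inner_conj H (innerZ a H Df) Dh) ipZl//.
by rewrite rmorphM /= -(inner_conj H).
Qed.

Lemma ip_ge0 f : inner_product D ip -> D f -> 0 <= ip f f.
Proof.
move=> H Df; have [->|f0] := eqVneq f 0; first by rewrite (ip0l H (inner0 H)).
by rewrite ltW// (inner_pos H).
Qed.

Lemma sqr_hnorm f : inner_product D ip -> D f -> (norm f ^+ 2)%:C = ip f f.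
Proof.
move=> H Df; have := ip_ge0 H Df; rewrite /hnorm.
case: (ip f f) => a b; rewrite lecE /= => /andP[/eqP -> a0].
by rewrite sqr_sqrtr.
Qed.

Lemma hnorm_ge0 f : 0 <= norm f.
Proof. exact: sqrtr_ge0. Qed.

Lemma hnorm_eq0 f : inner_product D ip -> D f -> norm f = 0 -> f = 0.
Proof.
move=> H Df f0; apply/eqP/negP => /negP fn0; have := inner_pos H Df fn0.
by rewrite -sqr_hnorm// f0 expr0n ltxx.
Qed.

(* the square of the distance from [f] to the line spanned by [g] *)
Lemma ip_proj f g : inner_product D ip -> D f -> D g -> g != 0 ->
  let h := f - (ip f g / ip g g) *: g in
  ip h h = ip f f - ip f g * (ip f g)^* / ip g g.
Proof.
move=> H Df Dg g0 h; have gg := inner_pos H Dg g0.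
have Dcg := innerZ (ip f g / ip g g) H Dg; have Dh := innerB H Df Dcg.
have hg : ip h g = 0 by rewrite ipBl// ipZl// mulfVK ?gt_eqF// subrr.
rewrite {2}/h ipBr// ipZr// hg mulr0 subr0 ipBl// ipZl//.
by rewrite (inner_conj H Df Dg) mulrAC.
Qed.

(** The squared distance from [f] to the line spanned by [g], given by [ip_proj], is nonnegative. *)
Lemma cauchy_schwarz f g : inner_product D ip -> D f -> D g ->
  normc (ip f g) <= norm f * norm g.
Proof.
move=> H Df Dg; have [->|g0] := eqVneq g 0.
  by rewrite (inner_conj H (inner0 H) Df) ip0l// conjc0 normc0 mulr_ge0 ?hnorm_ge0.
rewrite -(@ler_pXn2r _ 2%N)// ?nnegrE ?normc_ge0 ?mulr_ge0 ?hnorm_ge0//.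
have gg := inner_pos H Dg g0; have Dcg := innerZ (ip f g / ip g g) H Dg.
have := ip_ge0 H (innerB H Df Dcg); rewrite ip_proj// subr_ge0 ler_pdivrMr//.
rewrite -!sqr_hnorm// -sqr_normc -rmorphM /= -exprMn => h.
by rewrite -lecR rmorphXn.
Qed.

Lemma hnormZ a f : inner_product D ip -> D f ->
  norm (a *: f) = normc a * norm f.
Proof.
move=> H Df; apply/eqP.
rewrite -(@eqrXn2 _ 2%N)// ?mulr_ge0 ?hnorm_ge0 ?normc_ge0//.
have Da := innerZ a H Df.
apply/eqP/(@complexI R); rewrite sqr_hnorm// ipZl// ipZr// mulrA -sqr_normc.
by rewrite exprMn rmorphM /= sqr_hnorm// rmorphXn.
Qed.

Lemma sqr_hnormD f g : inner_product D ip -> D f -> D g ->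
  norm (f + g) ^+ 2 = norm f ^+ 2 + norm g ^+ 2 + 2 * complex.Re (ip f g).
Proof.
move=> H Df Dg; have Dfg := innerD H Df Dg.
have e x : D x -> norm x ^+ 2 = complex.Re (ip x x).
  by move=> Dx; rewrite -sqr_hnorm.
rewrite !e// ipDl// !ipDr// (inner_conj H Df Dg).
move: (ip f f) (ip f g) (ip g g) => [a b] [c d] [k l] /=; ring.
Qed.

Lemma hnormN f : inner_product D ip -> D f -> norm (- f) = norm f.
Proof. by move=> H Df; rewrite -scaleN1r hnormZ// normcN normc1 mul1r. Qed.

Lemma hnorm_triangle f g : inner_product D ip -> D f -> D g ->
  norm (f + g) <= norm f + norm g.
Proof.
move=> H Df Dg; rewrite -(@ler_pXn2r _ 2%N)// ?nnegrE ?addr_ge0 ?hnorm_ge0//.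
have := cauchy_schwarz H Df Dg; have := Re_le_normc (ip f g).
have := ler_norm (complex.Re (ip f g)).
rewrite sqr_hnormD// sqrrD; lra.
Qed.

Lemma parallelogram f g : inner_product D ip -> D f -> D g ->
  norm (f + g) ^+ 2 + norm (f - g) ^+ 2 = 2 * norm f ^+ 2 + 2 * norm g ^+ 2.
Proof.
move=> H Df Dg; have DN := innerN H Dg.
rewrite !sqr_hnormD// hnormN// (inner_conj H DN Df) ipNl//.
rewrite (inner_conj H Df Dg); case: (ip f g) => a b /=; ring.
Qed.

Lemma hilbert_inner : hilbert_space D ip -> inner_product D ip.
Proof. by case=> *; split. Qed.

Definition hcvg (u : nat -> V) f :=
  forall e : R, 0 < e -> exists n0, forall n, (n0 <= n)%N -> norm (u n - f) < e.

(* Orthogonal projection onto [M]: a minimizing sequence for the distance to [f]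
   is Cauchy by the parallelogram law, and [f] minus its limit is orthogonal to
   [M]. *)
Lemma hilbert_total (M : set V) : hilbert_space D ip ->
  M `<=` D -> M 0 -> (forall a f g, M f -> M g -> M (a *: f + g)) ->
  (forall u f, (forall n, M (u n)) -> D f -> hcvg u f -> M f) ->
  (forall f, D f -> (forall h, M h -> ip f h = 0) -> f = 0) ->
  D `<=` M.
Proof.
move=> HD MD M0 Mlin Mcl Mtot f Df; have H := hilbert_inner HD.
pose S := [set norm (f - g) | g in M].
have S0 : S !=set0 by exists (norm (f - 0)); exists 0.
have Slb : has_lbound S by exists 0 => _ [g _ <-]; exact: hnorm_ge0.
have infS : has_inf S by [].
set d := inf S.
have d0 : 0 <= d by apply: lb_le_inf => // _ [g _ <-]; exact: hnorm_ge0.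
have dle g : M g -> d <= norm (f - g).
  by move=> Mg; apply: ge_inf => //; exists g.
have ex n : exists g, M g /\ norm (f - g) < d + n.+1%:R^-1.
  have n1 : 0 < n.+1%:R^-1 :> R by rewrite invr_gt0.
  by have [_ [g Mg <-] gd] := inf_adherent n1 infS; exists g.
have [u uP] := choice ex.
have Du n : D (u n) by apply: MD; have [] := uP n.
have half (x y z : V) : x - z + (x - y) = 2 *: (x - (2^-1 *: y + 2^-1 *: z)).
  rewrite scalerBr scalerDr !scalerA mulfV ?pnatr_eq0// !scale1r scaler_nat.
  by rewrite mulr2n opprD addrACA [- z - y]addrC.
have cau (e : R) : 0 < e -> exists n0, forall m n,
    (n0 <= m)%N -> (n0 <= n)%N -> norm (u m - u n) < e.
  move=> e0.
  (* With i = 1 / (k + 1), the midpoint being at distance at least d, the parallelogram law bounds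
     the squared gap by 4 (d + i)^2 - 4 d^2 <= i (8 d + 4). *)
  have [k kP] : exists k : nat, (k.+1%:R^-1 : R) * (8 * d + 4) < e ^+ 2.
    have c0 : 0 < 8 * d + 4 by lra.
    have q0 : 0 < e ^+ 2 / (8 * d + 4) by rewrite divr_gt0 ?exprn_gt0.
    have [k _ hk] := near_infty_natSinv_lt (PosNum q0).
    exists k; rewrite -ltr_pdivlMr//; apply: hk => /=; exact: leqnn.
  exists k => m n km kn.
  have dk j : (k <= j)%N -> norm (f - u j) < d + k.+1%:R^-1.
    move=> kj; have [_ h] := uP j; rewrite (lt_le_trans h)// lerD2l.
    by rewrite lef_pV2 ?posrE// ler_nat.
  have Dm := innerB H Df (Du m); have Dn := innerB H Df (Du n).
  have := parallelogram H Dn Dm.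
  have -> : f - u n - (f - u m) = u m - u n.
    by rewrite opprB [LHS]addrC -addrA addKr.
  rewrite half; set z := _ *: u m + _.
  have Mz : M z.
    apply: (Mlin); first by have [] := uP m.
    by rewrite -[_ *: u n]addr0; apply: (Mlin) => //; have [] := uP n.
  have dz := dle _ Mz; have Dfz := innerB H Df (MD _ Mz).
  rewrite hnormZ// normc2.
  have := dk _ km; have := dk _ kn; have := hnorm_ge0 (f - u m).
  have := hnorm_ge0 (f - u n); have := hnorm_ge0 (u m - u n).
  have k1 : (k.+1%:R^-1 : R) <= 1 by rewrite invf_le1// ler1n.
  have k0 : 0 <= (k.+1%:R^-1 : R) by rewrite invr_ge0.
  move: (norm (u m - u n)) (norm (f - u m)) (norm (f - u n)) => x y w.
  move: (norm (f - z)) dz => v dz x0 w0 y0 wd yd par.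
  move: (k.+1%:R^-1) k0 k1 kP wd yd => i i0 i1 ie wd yd.
  rewrite -(@ltr_pXn2r _ 2%N)// ?nnegrE ?(ltW e0)//.
  have w2 : w ^+ 2 <= (d + i) ^+ 2 by rewrite lerXn2r ?nnegrE ?addr_ge0// ltW.
  have y2 : y ^+ 2 <= (d + i) ^+ 2 by rewrite lerXn2r ?nnegrE ?addr_ge0// ltW.
  have v2 : d ^+ 2 <= v ^+ 2 by rewrite lerXn2r ?nnegrE ?(le_trans d0).
  rewrite exprMn in par.
  have i2 : i ^+ 2 <= i by rewrite expr2; nra.
  have : (d + i) ^+ 2 = d ^+ 2 + 2 * d * i + i ^+ 2 by ring.
  lra.
have [l Dl lP] := hilbert_complete HD Du cau.
have Ml : M l by apply: (Mcl u) => // n; have [] := uP n.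
have fl : norm (f - l) <= d.
  apply/ler_addgt0Pr => e e0.
  have e2 : 0 < e / 2 by rewrite divr_gt0.
  have [n0 hn] := lP _ e2.
  have [k _ hk] := near_infty_natSinv_lt (PosNum e2).
  have [_ h1] := uP (maxn n0 k).
  have h2 := hn _ (leq_maxl n0 k); have h3 := hk _ (leq_maxr n0 k).
  have := hnorm_triangle H (innerB H Df (Du (maxn n0 k)))
    (innerB H (Du (maxn n0 k)) Dl).
  rewrite addrA subrK => h4.
  move: (_^-1) (norm (f - u _)) (norm (u _ - l)) (norm (f - l)) h1 h2 h3 h4.
  move=> /= i x y z h1 h2 h3 h4; lra.
have Dfl := innerB H Df Dl.
suff : f - l = 0 by move=> /eqP; rewrite subr_eq0 => /eqP ->.
(* Moving [l] along [h] to the best point stays in [M], so it cannot bring the distance below [d].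
   By [ip_proj] the gain is |<f - l, h>|^2 / <h, h>, which must vanish. *)
apply: Mtot => // h Mh; have [->|h0] := eqVneq h 0.
  by rewrite (inner_conj H (inner0 H) Dfl) ip0l// conjc0.
have Dh := MD _ Mh; have hh := inner_pos H Dh h0.
have Dch := innerZ (ip (f - l) h / ip h h) H Dh.
have := ip_proj H Dfl Dh h0; rewrite /= -[in LHS]sqr_hnorm//; last exact: innerB.
rewrite -addrA -opprD; set g := l + _.
have Mg : M g by rewrite /g addrC; apply: (Mlin).
have := dle _ Mg; rewrite -sqr_hnorm// => dg e.
have : (norm (f - l) ^+ 2)%:C <= (norm (f - g) ^+ 2)%:C.
  by rewrite lecR lerXn2r ?nnegrE ?hnorm_ge0// (le_trans fl).
rewrite e -subr_ge0 addrAC subrr add0r oppr_ge0 -sqr_normc => a0.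
have : `|ip (f - l) h| ^+ 2 = 0.
  apply/eqP; rewrite eq_le exprn_ge0// andbT.
  by move: a0; rewrite ler_pdivrMr// mul0r.
by move=> /eqP; rewrite expf_eq0 normr_eq0 => /eqP.
Qed.

End InnerProductTheory.

(** * Limits of inner products and of bounded operators *)

Section HilbertLimits.
Variables (R : realType) (V : lmodType R[i]).
Local Notation C := R[i].
Variables (D : set V) (ip : V -> V -> C).
Local Notation norm := (hnorm ip).

Lemma hcvg_cauchy u l : inner_product D ip -> (forall n, D (u n)) -> D l ->
  hcvg ip u l -> forall e : R, 0 < e -> exists n0, forall m n,
    (n0 <= m)%N -> (n0 <= n)%N -> norm (u m - u n) < e.
Proof.
move=> H Du Dl ul e e0; have e2 : 0 < e / 2 by rewrite divr_gt0.
have [n0 hn] := ul _ e2; exists n0 => m n n0m n0n.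
have h1 := hn _ n0m; have := hn _ n0n.
rewrite -[norm (u n - l)](hnormN H (innerB H (Du n) Dl)) opprB.
have := hnorm_triangle H (innerB H (Du m) Dl) (innerB H Dl (Du n)).
rewrite addrA subrK; lra.
Qed.

(** Cauchy-Schwarz on both sides. This gives the closedness that [hilbert_total] asks for. *)
Lemma hcvg_ip_eq u v l k f g : inner_product D ip ->
  (forall n, D (u n)) -> (forall n, D (v n)) -> D l -> D k -> D f -> D g ->
  hcvg ip u l -> hcvg ip v k -> (forall n, ip f (u n) = ip (v n) g) ->
  ip f l = ip k g.
Proof.
move=> H Du Dv Dl Dk Df Dg ul vk e; apply/eqP; rewrite -subr_eq0.
apply/eqP/eq0_normc/eqP; rewrite eq_le normc_ge0 andbT.
apply/ler_addgt0Pr => d d0; rewrite add0r.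
(* The 1 keeps [c] positive when [f] and [g] are both zero. *)
pose c := norm f + norm g + 1.
have f0 := hnorm_ge0 ip f; have g0 := hnorm_ge0 ip g.
have dc : 0 < d / c by rewrite divr_gt0// /c; lra.
have [n1 h1] := ul _ dc; have [n2 h2] := vk _ dc; pose n := maxn n1 n2.
have := h1 n (leq_maxl _ _); have := h2 n (leq_maxr _ _).
have -> : ip f l - ip k g = ip (v n - k) g - ip f (u n - l).
  by rewrite (ipBl H)// (ipBr H)// e; ring.
move: (cauchy_schwarz H (innerB H (Dv n) Dk) Dg).
move: (cauchy_schwarz H Df (innerB H (Du n) Dl)).
have := le_normcD (ip (v n - k) g) (- ip f (u n - l)); rewrite normcN.
have : c * (d / c) = d by rewrite mulrC mulfVK// /c gt_eqF//; lra.
move: (d / c) (hnorm_ge0 ip (v n - k)) (hnorm_ge0 ip (u n - l)) => r.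
rewrite /c; move: (normc (_ - _)) (normc (ip _ g)) (normc (ip f _)).
move: (norm (v n - k)) (norm (u n - l)) => *; nra.
Qed.

Lemma bounded_operatorB T f g : inner_product D ip ->
  bounded_operator D ip T -> D f -> D g -> T (f - g) = T f - T g.
Proof.
move=> H HT Df Dg; rewrite addrC -scaleN1r (bop_lin HT)//.
by rewrite scaleN1r addrC.
Qed.

Lemma bounded_operator_hcvg T u l : inner_product D ip ->
  bounded_operator D ip T -> (forall n, D (u n)) -> D l ->
  hcvg ip u l -> hcvg ip (T \o u) (T l).
Proof.
move=> H HT Du Dl ul e e0; have [M MP] := bop_bound HT.
(* The bound [M] comes with no sign and may be 0. *)
have dc : 0 < e / (`|M| + 1) by rewrite divr_gt0// ltr_wpDl.
have [n0 hn] := ul _ dc; exists n0 => n /hn h /=.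
rewrite -(bounded_operatorB H)//; have Dd := innerB H (Du n) Dl.
apply: (le_lt_trans (MP _ Dd)).
apply: (@le_lt_trans _ _ ((`|M| + 1) * norm (u n - l))).
  by rewrite ler_wpM2r ?hnorm_ge0// (le_trans (ler_norm _))// lerDl.
by rewrite mulrC -ltr_pdivlMr// ltr_wpDl.
Qed.

End HilbertLimits.

(** * The conjugation J on the Dirichlet space *)
Section EuclideanBall.
Variables (R : realType) (N : nat).
Local Notation C := (R[i]).
Local Notation B := (ballT R N).
Implicit Types z w : 'cV[C]_N.

Local Notation conjv := (@map_mx _ _ (@Num.conj C) N 1).

(* In [cdot] the conjugation is [Num.conj], elsewhere it is [conjc]; the two are
   convertible but not syntactically equal. *)
Lemma conjcCK (x : C) : conjc (Num.conj x) = x.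
Proof. exact: conjCK. Qed.

Lemma cdot_inner : inner_product [set: 'cV[C]_N] (@cdot R N).
Proof.
split => //.
- move=> a f g h _ _ _; rewrite /cdot mulr_sumr -big_split; apply: eq_bigr => i _.
  by rewrite !mxE mulrDl mulrA.
- move=> f g _ _; rewrite /cdot rmorph_sum; apply: eq_bigr => i _.
  by rewrite [RHS]rmorphM /= conjcCK mulrC.
- move=> f _ f0; have ge0 i : 0 <= f i 0 * (f i 0)^*.
    by rewrite -sqr_normc exprn_ge0.
  rewrite lt_def sumr_ge0// andbT; apply: contra f0 => /eqP.
  move=> /psumr_eq0P e; apply/eqP/colP => i; rewrite mxE.
  have /eqP := e (fun j _ => ge0 j) i isT.
  by rewrite -sqr_normc expf_eq0 normr_eq0 => /eqP.
Qed.

Lemma normc_cdot_lt1 (z w : B) : normc (cdot (val z) (val w)) < 1.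
Proof.
have := valP z; have := valP w; rewrite /unit_ball /= => w1 z1.
apply: (le_lt_trans (cauchy_schwarz cdot_inner _ _)) => //.
have := hnorm_ge0 (@cdot R N) (val z); have := hnorm_ge0 (@cdot R N) (val w).
rewrite /enorm in z1 w1; rewrite -!/(hnorm _ _) in z1 w1 *; nra.
Qed.

Lemma cdot_conjv z w : cdot (conjv z) (conjv w) = (cdot z w)^*.
Proof.
rewrite /cdot rmorph_sum; apply: eq_bigr => i _.
by rewrite !mxE rmorphM.
Qed.

Lemma conjvK : involutive conjv.
Proof. by move=> z; apply/matrixP => i j; rewrite !mxE conjCK. Qed.

Lemma conjBK : involutive (@conjB R N).
Proof. by move=> z; apply: val_inj; rewrite /= conjvK. Qed.

(** The bilinear form [z, w], written through [cdot] so that its properties are inherited. *)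
Definition bil z w : C := cdot z (conjv w).

Lemma bilE z w : bil z w = \sum_i z i 0 * w i 0.
Proof. by apply: eq_bigr => i _; rewrite mxE conjCK. Qed.

Lemma bilC z w : bil z w = bil w z.
Proof. by rewrite !bilE; apply: eq_bigr => i _; rewrite mulrC. Qed.

End EuclideanBall.

(** * Density of the kernels and adjoints *)

Section Dirichlet.
Variables (R : realType) (N : nat).
Local Notation C := (R[i]).
Local Notation B := (ballT R N).
Local Notation K := (@dirichlet_kernel R N).
Local Notation J := (@conjJ R N).
Variables (D : set (B -> C)) (ip : (B -> C) -> (B -> C) -> C).
Hypothesis HD : dirichlet_space D ip.

Let HH := dirichlet_hilbert HD.
Let H := hilbert_inner HH.
Let DK := dirichlet_kernel_in HD.
Let rep := dirichlet_reproducing HD.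

Lemma conjJ_lin (a : C) f g : J (a *: f + g) = a^* *: J f + J g.
Proof. by apply/funext => z; rewrite /conjJ /= rmorphD rmorphM. Qed.

Lemma conjJB f g : J (f - g) = J f - J g.
Proof. by apply/funext => z; rewrite /conjJ /= rmorphB. Qed.

Lemma conjJK : involutive J.
Proof. by move=> f; apply/funext => z; rewrite /conjJ /= conjBK conjcK. Qed.

Lemma kernelE w z : K w z = 1 + clnV1B (cdot (val z) (val w)).
Proof. by []. Qed.

Lemma conjJ_kernel w : J (K w) = K (conjB w).
Proof.
apply/funext => z; rewrite /conjJ !kernelE rmorphD rmorph1; congr (1 + _).
apply: etrans (esym (clnV1B_conj (normc_cdot_lt1 _ _))) _; congr clnV1B.
rewrite -cdot_conjv; congr cdot; by rewrite /= conjvK.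
Qed.

Lemma reproducing_l f w : D f -> ip (K w) f = (f w)^*.
Proof. by move=> Df; rewrite (inner_conj H Df (DK w)) -rep. Qed.

Lemma kernel_total f : D f -> (forall w, ip f (K w) = 0) -> f = 0.
Proof. by move=> Df f0; apply/funext => w; rewrite rep// f0. Qed.

(* [D] is only known through its kernel, so that even its stability under [J]
   comes from the density of the kernels: the functions satisfying the
   conclusion form a closed subspace that contains them. *)
Lemma conjJ_stable_isom f : D f -> D (J f) /\
  forall h, D h -> D (J h) -> ip (J f) (J h) = ip h f.
Proof.
(* The clause on [h] assumes [D (J h)], because stability under [J] is still to be proved. *)
pose M := [set f | [/\ D f, D (J f) &
  forall h, D h -> D (J h) -> ip (J f) (J h) = ip h f]].
suff DM : D `<=` M by move=> /DM [].
have Mlin (a : C) x y : M x -> M y -> M (a *: x + y).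
  move=> [Dx DJx ex] [Dy DJy ey]; split; first exact: (inner_lin H).
    by rewrite conjJ_lin; exact: (inner_lin H).
  move=> h Dh DJh; rewrite conjJ_lin (inner_linl H)// ex// ey//.
  by rewrite (ipDr H) ?(ipZr _ H)//; exact: (innerZ _ H).
have JN : J 0 = 0 by apply/funext => z; rewrite /conjJ conjc0.
have norm_eq x : M x -> hnorm ip (J x) = hnorm ip x.
  by move=> [Dx DJx ex]; rewrite /hnorm ex.
apply: (hilbert_total HH) => //.
- by move=> x [].
- split; rewrite ?JN; try exact: inner0 H.
  move=> h Dh DJh; rewrite (ip0l H)//.
  by rewrite (inner_conj H (inner0 H) Dh) (ip0l H)// conjc0.
- move=> u l Mu Dl ul; pose v n := J (u n).
  have Du n : D (u n) by case: (Mu n).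
  have Dv n : D (v n) by case: (Mu n).
  have cau (e : R) : 0 < e -> exists n0, forall m n,
      (n0 <= m)%N -> (n0 <= n)%N -> hnorm ip (v m - v n) < e.
    move=> /(hcvg_cauchy H Du Dl ul) [n0 hn]; exists n0 => m n mn nn.
    rewrite -conjJB norm_eq ?hn// addrC -scaleN1r; exact: Mlin.
  have [g Dg vg] := hilbert_complete HH Dv cau.
  (* Norm limits are pointwise limits, by pairing with the kernels; this identifies the limit of
     [J (u n)]. *)
  have gE : g = J l.
    apply/funext => z; rewrite rep// /conjJ -reproducing_l//.
    apply/esym; apply: (hcvg_ip_eq H Du Dv) => // n.
    by rewrite reproducing_l// -rep.
  split => //; rewrite -gE// => h Dh DJh; apply/esym.
  apply: (hcvg_ip_eq H Du Dv) => // n.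
  by have [_ _ ->] := Mu n.
- move=> k Dk k0; apply: kernel_total => // w; apply: k0.
  split; rewrite ?conjJ_kernel//.
  move=> h Dh DJh; rewrite reproducing_l// /conjJ conjBK conjcK.
  exact: rep.
Qed.

Lemma conjugation_conjJ : conjugation D ip J.
Proof.
split.
- by move=> f /conjJ_stable_isom [].
- by move=> a f g _ _; exact: conjJ_lin.
- by move=> f _; exact: conjJK.
- move=> f g Df Dg; have [DJg _] := conjJ_stable_isom Dg.
  by have [_ e] := conjJ_stable_isom Df; exact: e.
Qed.

(** As [J] is isometric, the adjoint relation at [g] says that <T f, g> = <T J g, J f>. The
    hypothesis is the case where [g] is a kernel, and both sides are continuous and antilinear in
    [g]. *)
Lemma conjJ_adjoint T : bounded_operator D ip T ->
  (forall f w, D f -> ip (T f) (K w) = ip (T (K (conjB w))) (J f)) ->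
  is_adjoint D ip T (fun g => J (T (J g))).
Proof.
move=> HT TK; have [Jst _ _ Jis] := conjugation_conjJ.
have DJT f : D f -> D (T (J f)).
  by move=> Df; apply: bop_stable HT _ _; exact: Jst.
split; first by move=> f Df; apply: Jst; exact: DJT.
suff : D `<=` [set g | D g /\ forall f, D f -> ip (T f) g = ip (T (J g)) (J f)].
  move=> DM f g Df /DM [Dg ->//].
  by rewrite -{2}[f]conjJK (Jis _ _ (Jst _ Df) (DJT _ Dg)).
apply: (hilbert_total HH).
- by move=> g [].
- split=> [|f Df]; first exact: inner0 H.
  have J0 : J 0 = 0 by apply/funext => z; rewrite /conjJ conjc0.
  have T0 : T 0 = 0.
    have := bounded_operatorB H HT (inner0 H) (inner0 H).
    by rewrite !subrr.
  have DTf := bop_stable HT Df.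
  rewrite J0 T0 (ip0l H (Jst _ Df)) (inner_conj H (inner0 H) DTf).
  by rewrite (ip0l H DTf) conjc0.
- move=> a g h [Dg eg] [Dh eh]; split=> [|f Df]; first exact: (inner_lin H).
  have DTf := bop_stable HT Df; have DJf := Jst _ Df.
  rewrite (ipDr H) ?(ipZr _ H) ?eg ?eh//; last exact: (innerZ _ H).
  rewrite conjJ_lin (bop_lin HT) ?(inner_linl H)//; by [exact: DJT|exact: Jst].
- move=> u l Mu Dl ul; split=> // f Df.
  have Du n : D (u n) by case: (Mu n).
  have Jul : hcvg ip (J \o u) (J l).
    move=> e /ul [n0 hn]; exists n0 => n /hn; rewrite /= -conjJB /hnorm Jis//;
    exact: (innerB H).
  apply: (hcvg_ip_eq H Du (fun n => DJT _ (Du n))) => //.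
  - exact: DJT.
  - exact: bop_stable HT _ _.
  - exact: Jst.
  - apply: (bounded_operator_hcvg H HT _ _ Jul); last exact: Jst.
    by move=> n; exact: Jst.
  - by move=> n; have [_ ->] := Mu n.
- move=> k Dk k0; apply: kernel_total => // w; apply: k0; split=> // f Df.
  by rewrite conjJ_kernel TK.
Qed.

(** The operator sends the kernel at the conjugate of w to c times the kernel at the conjugate of
    phi(w). Both sides of the criterion in [conjJ_adjoint] are then c f(phi(w)). *)
Lemma weighted_comp_adjoint (psi : B -> C) (phi : B -> B) (c : C) :
  bounded_operator D ip (weighted_comp psi phi) -> (forall z, psi z = c) ->
  (forall z w, bil (val (phi z)) (val w) = bil (val z) (val (phi w))) ->
  complex_symmetric D ip (weighted_comp psi phi) J.
Proof.
move=> HW psic sym; split; first exact: conjugation_conjJ.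
exists (fun g => J (weighted_comp psi phi (J g))); last first.
  by move=> f Df; rewrite conjJK.
have [Jst _ _ _] := conjugation_conjJ.
apply: conjJ_adjoint => // f w Df.
have -> : weighted_comp psi phi (K (conjB w)) = c *: K (conjB (phi w)).
  apply/funext => z; rewrite /weighted_comp psic !kernelE.
  by congr (_ * (1 + clnV1B _)); exact: sym.
rewrite -rep; last exact: bop_stable HW _ _.
rewrite (ipZl _ H) ?reproducing_l//; try exact: Jst.
by rewrite /conjJ conjBK conjcK /weighted_comp psic.
Qed.

(** The relation W J = J W* is applied to K_w and evaluated at z. On the right, the reproducing
    property and the adjoint turn the value into that of W K at w, for the kernel K at the conjugate
    of z. *)
Lemma complex_symmetric_kernel (psi : B -> C) (phi : B -> B) z w :
  bounded_operator D ip (weighted_comp psi phi) ->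
  complex_symmetric D ip (weighted_comp psi phi) J ->
  psi z * (1 + clnV1B (bil (val (phi z)) (val w))) =
  psi w * (1 + clnV1B (bil (val (phi w)) (val z))).
Proof.
move=> HW [_ [S [Sst Sadj] WJ]].
have := congr1 (fun f => f z) (WJ _ (DK w)).
rewrite /weighted_comp conjJ_kernel kernelE => ->.
rewrite /conjJ rep; last exact: Sst.
rewrite (inner_conj H (DK _) (Sst _ (DK w))) conjcK -Sadj// -rep.
  by rewrite /weighted_comp kernelE.
exact: bop_stable HW _ _.
Qed.

End Dirichlet.

(** * Rigidity of the symbols *)
Section DirectionalDerivative.
Variable K : numFieldType.

Lemma derivable_cvg0 (m n : nat) (F : 'cV[K]_m -> 'cV[K]_n) (w : 'cV[K]_m) :
  derivable F 0 w ->
  exists v : 'cV[K]_n, forall i,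
    cvg0 (fun t => t^-1 * (F (t *: w) i 0 - F 0 i 0)) (v i 0).
Proof.
move=> /cvg_ex [/= v Fv]; exists v => i; apply/cvg0P.
have h := @cvg_comp _ _ _ _ _ _ _ _ Fv (@coord_continuous K n 1 i 0 v).
apply: cvg_trans h; apply: near_eq_cvg; apply/near0P; exists 1 => // t _ _ /=.
by rewrite !mxE addr0.
Qed.

Lemma derive_near_linear (m : nat) (f : 'cV[K]_m -> K^o)
    (w : 'cV[K]_m) (a : K) :
  f 0 = 0 -> near0 (fun t => f (t *: w) = t * a) -> 'D_w f 0 = a.
Proof.
move=> f0 E; apply: (@cvg_lim _ _ _ _ _ _ (a : K^o)); first exact: norm_hausdorff.
apply/cvg0P; apply: cvg0_eq (cvg0_slope a); apply: near0W E => t e.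
by rewrite /= addr0 f0 subr0 e.
Qed.

End DirectionalDerivative.

(** * Rays in the ball and derivatives at 0 *)

Section BallMaps.
Variables (R : realType) (N : nat).
Local Notation C := R[i].
Local Notation B := (ballT R N).
Implicit Types (z w : B) (phi : B -> B).

Lemma unit_ballZ (t : C) w : normc t <= 1 -> unit_ball (t *: val w).
Proof.
move=> t1; rewrite /unit_ball.
have -> : enorm (t *: val w) = normc t * enorm (val w).
  exact: (hnormZ _ (@cdot_inner R N)).
have := valP w; have := hnorm_ge0 (@cdot R N) (val w); have := normc_ge0 t.
rewrite /unit_ball /= -[hnorm _ _]/(enorm _); nra.
Qed.

Lemma unit_ball0 : unit_ball (0 : 'cV[C]_N).
Proof.
rewrite /unit_ball /enorm -[Num.sqrt _]/(hnorm (@cdot R N) 0) /hnorm.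
by rewrite (ip0l (@cdot_inner R N))// sqrtr0.
Qed.

Definition ball0 : B := exist _ 0 unit_ball0.

(* Equal to [ball0] when [t *: val w] is outside the ball. *)
Definition ballZ (t : C) w : B := insubd ball0 (t *: val w).

Lemma val_ballZ (t : C) w : normc t <= 1 -> val (ballZ t w) = t *: val w.
Proof. by move=> t1; rewrite /ballZ insubdK//; exact: unit_ballZ. Qed.

Lemma ext0_val (V : zmodType) (f : B -> V) z : ext0 f (val z) = f z.
Proof. by rewrite /ext0 valK. Qed.

Lemma ext0_0 (V : zmodType) (f : B -> V) : ext0 f 0 = f ball0.
Proof. exact: (ext0_val f ball0). Qed.

Lemma near0_normc : near0 (fun t : C => normc t <= 1).
Proof. by exists 1 => // t _; rewrite ltcE => /andP[_ /ltW]. Qed.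

Lemma ext0_ballZ (V : zmodType) (f : B -> V) w :
  near0 (fun t => ext0 f (t *: val w) = f (ballZ t w)).
Proof.
apply: near0W near0_normc => t t1.
by rewrite -val_ballZ// ext0_val.
Qed.

(** The vector [v] is the derivative of [phi] at 0 along [w]. That it serves every [z] is the source
    of linearity in [z] later. *)
Lemma holomorphic_direction phi w : holomorphic_self_map phi ->
  exists v : 'cV[C]_N, forall z,
    cvg0 (fun t => t^-1 * (bil (val (phi (ballZ t w))) (val z) -
      bil (val (phi ball0)) (val z))) (bil v (val z)).
Proof.
move=> phi_hol.
have /derivable_cvg0 [v vP] := diff_derivable (v := val w) (phi_hol ball0).
exists v => z; rewrite (bilE v).
have h := cvg0_sum (index_enum 'I_N)
  (fun i => cvg0M (vP i) (cvg0_cst (val z i 0))).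
apply: cvg0_eq h; apply: near0W (ext0_ballZ (fun z => val (phi z)) w) => t e.
rewrite e ext0_0 !bilE -sumrB mulr_sumr.
by apply: eq_bigr => i _; rewrite -mulrA mulrBl.
Qed.

Lemma normc_half : normc (2^-1 : C) = 2^-1.
Proof. by rewrite normcV normc2. Qed.

Lemma unit_ball_half_delta (j : 'I_N) :
  unit_ball ((2^-1 : C) *: delta_mx j 0 : 'cV[C]_N).
Proof.
rewrite /unit_ball.
have -> : enorm ((2^-1 : C) *: delta_mx j 0 : 'cV[C]_N) =
    normc (2^-1 : C) * enorm (delta_mx j 0 : 'cV[C]_N).
  exact: (hnormZ _ (@cdot_inner R N)).
rewrite normc_half /enorm /cdot (bigD1 j)//= big1 => [|i ij]; last first.
  by rewrite !mxE (negbTE ij) mul0r.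
by rewrite !mxE !eqxx conjC1 mulr1 addr0 sqrtr1; lra.
Qed.

(** Basis vectors lie on the unit sphere; their halves lie in the open ball and still read off
    coordinates. *)
Definition half_delta (j : 'I_N) : B :=
  exist (fun w : 'cV[C]_N => unit_ball w) _ (unit_ball_half_delta j).

Lemma jacobian0_linear phi (A : 'M[C]_N) :
  (forall z, val (phi z) = A *m val z) -> jacobian0 phi = A.
Proof.
move=> phiA; apply/matrixP => i j; rewrite mxE.
apply: derive_near_linear.
  by rewrite ext0_0 phiA mulmx0 mxE.
(* For |t| < 1/2 the point t e_j = (2t)(e_j / 2) is in the ball, where [ext0] agrees with [phi]. *)
exists (2^-1) => [|t t0 t2]; first by rewrite invr_gt0.
have t21 : normc (t * 2) <= 1.
  rewrite -lecR -[(normc _)%:C]/(`|t * 2|) normrM normr_nat -ler_pdivlMr//.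
  by rewrite ltW// (lt_le_trans t2)// mul1r.
have -> : t *: delta_mx j 0 = val (ballZ (t * 2) (half_delta j)).
  by rewrite val_ballZ//= scalerA mulfK ?pnatr_eq0.
rewrite ext0_val phiA val_ballZ//.
by rewrite /= scalerA mulfK ?pnatr_eq0// -scalemxAr -colE !mxE.
Qed.

End BallMaps.

(** * The functional equation of the symbols *)

Section Rigidity.
Variables (R : realType) (N : nat).
Local Notation C := R[i].
Local Notation B := (ballT R N).
Implicit Types (z w : B) (phi : B -> B).

Lemma bilDl (x y : 'cV[C]_N) (u : 'cV[C]_N) : bil (x + y) u = bil x u + bil y u.
Proof. exact: (ipDl (@cdot_inner R N)). Qed.

Lemma bilZl (t : C) (x u : 'cV[C]_N) : bil (t *: x) u = t * bil x u.
Proof. exact: (ipZl _ (@cdot_inner R N)). Qed.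

Lemma bilZr (t : C) (x u : 'cV[C]_N) : bil x (t *: u) = t * bil x u.
Proof. by rewrite bilC bilZl bilC. Qed.

Lemma bilDr (x u v : 'cV[C]_N) : bil x (u + v) = bil x u + bil x v.
Proof. by rewrite bilC bilDl !(bilC x). Qed.

Lemma bil0l (u : 'cV[C]_N) : bil 0 u = 0.
Proof. by rewrite -(scale0r 0) bilZl mul0r. Qed.

Lemma bil0r (u : 'cV[C]_N) : bil u 0 = 0.
Proof. by rewrite bilC bil0l. Qed.

Lemma normc_bil_lt1 z w : normc (bil (val z) (val w)) < 1.
Proof. exact: (normc_cdot_lt1 z (conjB w)). Qed.

(** Testing on the conjugates of [x] and [y] makes the difference orthogonal to both, hence to
    itself. *)
Lemma bil_val_inj (x y : B) :
  (forall w, bil (val x) (val w) = bil (val y) (val w)) -> x = y.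
Proof.
move=> xy; apply: val_inj; apply/eqP; rewrite -subr_eq0; apply/eqP.
apply: (hnorm_eq0 (@cdot_inner R N)) => //.
have e (w : B) : cdot (val x - val y) (val w) = 0.
  have := xy (conjB w); rewrite /bil /= conjvK => h.
  by rewrite (ipBl (@cdot_inner R N))// h subrr.
by rewrite /hnorm (ipBr (@cdot_inner R N))// !e subr0 sqrtr0.
Qed.

(** What [complex_symmetric_kernel] extracts from complex symmetry; this section works from it
    without the space [D]. *)
Definition log_symmetric (psi : B -> C) phi := forall z w,
  psi z * (1 + clnV1B (bil (val (phi z)) (val w))) =
  psi w * (1 + clnV1B (bil (val (phi w)) (val z))).

Lemma log_symmetric_weight psi phi z : log_symmetric psi phi ->
  psi z = psi (ball0 R N) *
    (1 + clnV1B (bil (val (phi (ball0 R N))) (val z))).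
Proof. by move=> /(_ z (ball0 R N)); rewrite /= bil0r clnV1B0 addr0 mulr1. Qed.

Lemma log_symmetric_eq psi phi z w : log_symmetric psi phi ->
  psi (ball0 R N) != 0 ->
  (1 + clnV1B (bil (val (phi (ball0 R N))) (val z))) *
    (1 + clnV1B (bil (val (phi z)) (val w))) =
  (1 + clnV1B (bil (val (phi (ball0 R N))) (val w))) *
    (1 + clnV1B (bil (val (phi w)) (val z))).
Proof.
move=> E c0; apply: (mulfI c0); by rewrite !mulrA -!log_symmetric_weight.
Qed.

(** [log_identity_order1] along the ray t w. The right-hand side is b(z, w), and [v] depends on [w]
    alone, so b is the restriction of a linear form in z. *)
Lemma log_symmetric_derivative psi phi w : holomorphic_self_map phi ->
  log_symmetric psi phi -> psi (ball0 R N) != 0 ->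
  exists v : 'cV[C]_N, forall z, bil v (val z) =
    (1 - bil (val (phi (ball0 R N))) (val z)) *
    (1 + clnV1B (bil (val (phi (ball0 R N))) (val z))) *
    (bil (val (phi z)) (val w) - bil (val (phi (ball0 R N))) (val w)).
Proof.
move=> phi_hol E c0; have [v vP] := holomorphic_direction w phi_hol.
exists v => z; set a := val (phi (ball0 R N)).
have s1 : normc (bil a (val z)) < 1 by exact: normc_bil_lt1.
rewrite -mulrA; set q := _ * (_ - _).
suff -> : q = bil v (val z) / (1 - bil a (val z)).
  by rewrite mulrC mulfVK ?sub1_neq0.
apply: (log_identity_order1 s1 (vP z)).
apply: near0W (near0_normc R) => t t1; rewrite addrC subrK; split.
  exact: normc_bil_lt1.
by have := log_symmetric_eq z (ballZ t w) E c0; rewrite -/a val_ballZ// !bilZr.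
Qed.

(* By [clnV1B_add], substituting the expressions of [phi z] and [phi (t w)] given
   by [log_symmetric_derivative] into [log_symmetric_eq] yields an instance of
   [log_identity_order2]. *)
Lemma log_symmetric_dichotomy psi phi z w : holomorphic_self_map phi ->
  log_symmetric psi phi -> psi (ball0 R N) != 0 ->
  bil (val (phi z)) (val w) = bil (val (phi (ball0 R N))) (val w) \/
  bil (val (phi (ball0 R N))) (val z) = 0.
Proof.
move=> phi_hol E c0; set a := val (phi (ball0 R N)).
have [v vP] := log_symmetric_derivative w phi_hol E c0.
have [v' vP'] := log_symmetric_derivative z phi_hol E c0.
rewrite -/a in vP vP'.
have s1 : normc (bil a (val z)) < 1 by exact: normc_bil_lt1.
have s0 := sub1_neq0 s1; have P0 := add1_clnV1B_neq0 s1.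
have : near0 (fun t =>
    (1 + clnV1B (bil a (val z))) * clnV1B (t * bil v (val z) /
      ((1 - bil a (val z)) * (1 - t * bil a (val w)) * (1 + clnV1B (bil a (val z))))) =
    (1 + clnV1B (t * bil a (val w))) * clnV1B (t * bil v' (val w) /
      ((1 - bil a (val z)) * (1 - t * bil a (val w)) *
       (1 + clnV1B (t * bil a (val w)))))).
  apply: near0W (near0_normc R) => t t1.
  have := log_symmetric_eq z (ballZ t w) E c0; rewrite -/a.
  have := vP' (ballZ t w).
  have h1 := normc_bil_lt1 (phi z) (ballZ t w).
  have h2 := normc_bil_lt1 (phi (ballZ t w)) z.
  have := normc_bil_lt1 (phi (ball0 R N)) (ballZ t w).
  move: h1 h2; rewrite -/a val_ballZ// !bilZr => h1 h2 t1' v't e.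
  have T0 := sub1_neq0 t1'; have Q0 := add1_clnV1B_neq0 t1'.
  have e1 : t * bil (val (phi z)) (val w) = t * bil a (val w) +
      t * bil v (val z) /
        ((1 - bil a (val z)) * (1 + clnV1B (bil a (val z)))).
    by rewrite vP; field; rewrite s0 P0.
  have e2 : bil (val (phi (ballZ t w))) (val z) = bil a (val z) +
      t * bil v' (val w) /
        ((1 - t * bil a (val w)) * (1 + clnV1B (t * bil a (val w)))).
    by rewrite v't; field; rewrite T0 Q0.
  rewrite e1 in h1; rewrite e2 in h2; rewrite e1 e2 !clnV1B_add// in e.
  move: (clnV1B (bil a (val z))) (clnV1B (t * bil a (val w))) P0 Q0 e => S Q P0 Q0 e.
  have d1 : t * bil v (val z) / ((1 - bil a (val z)) * (1 + S)) /
      (1 - t * bil a (val w)) =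
      t * bil v (val z) /
        ((1 - bil a (val z)) * (1 - t * bil a (val w)) * (1 + S)).
    by field; rewrite s0 T0 P0.
  have d2 : t * bil v' (val w) / ((1 - t * bil a (val w)) * (1 + Q)) /
      (1 - bil a (val z)) =
      t * bil v' (val w) /
        ((1 - bil a (val z)) * (1 - t * bil a (val w)) * (1 + Q)).
    by field; rewrite s0 T0 Q0.
  move: e; rewrite d1 d2.
  move: (clnV1B (_ / _)) (clnV1B (_ / _)) => X Y e.
  (* Both sides of the expanded identity contain this product. *)
  apply: (addrI ((1 + S) * (1 + Q))).
  rewrite -mulrDr -addrA e; ring.
move=> /(log_identity_order2 s1) [_ bs].
have [vz0|/bs] := eqVneq (bil v (val z)) 0; last by right.
left; apply/eqP; rewrite -subr_eq0; apply/eqP.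
have sP : (1 - bil a (val z)) * (1 + clnV1B (bil a (val z))) != 0.
  by rewrite mulf_neq0.
by apply: (mulfI sP); rewrite -vP vz0 mulr0.
Qed.

(** The dichotomy settles the points with [a, z] <> 0. If [a, z] = 0, the linear form b(., w)
    vanishes at the conjugate e of a and at the midpoint m of z and e, where [a, .] is nonzero,
    hence also at z. *)
Lemma log_symmetric_constant psi phi : holomorphic_self_map phi ->
  log_symmetric psi phi -> psi (ball0 R N) != 0 ->
  val (phi (ball0 R N)) != 0 -> forall z, phi z = phi (ball0 R N).
Proof.
move=> phi_hol E c0 a0 z; set a := phi (ball0 R N).
have dich y w := log_symmetric_dichotomy y w phi_hol E c0; rewrite -/a in dich.
apply: bil_val_inj => w; have [//|sz] := dich z w.
pose e := conjB a.
have se : bil (val a) (val e) != 0.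
  rewrite /e /bil /= conjvK.
  have := inner_pos (@cdot_inner R N) (f := val a) I a0.
  by case: eqP => // ->; rewrite ltxx.
have [v vP] := log_symmetric_derivative w phi_hol E c0; rewrite -/a in vP.
have mB : unit_ball ((2^-1 : C) *: val z + (2^-1 : C) *: val e).
  rewrite /unit_ball -[enorm _]/(hnorm (@cdot R N) _).
  have := hnorm_triangle (@cdot_inner R N) (f := 2^-1 *: val z)
    (g := 2^-1 *: val e) I I.
  rewrite !(hnormZ _ (@cdot_inner R N))// normc_half.
  have := valP z; have := valP e; rewrite /unit_ball /= -![enorm _]/(hnorm _ _).
  lra.
pose m : B := exist (fun w : 'cV[C]_N => unit_ball w) _ mB.
have ve : bil v (val e) = 0.
  by rewrite vP; have [->|/eqP] := dich e w; rewrite ?subrr ?mulr0// (negbTE se).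
have vm : bil v (val m) = 0.
  rewrite vP; have [->|/eqP] := dich m w; first by rewrite subrr mulr0.
  rewrite /= bilDr !bilZr sz mulr0 add0r mulf_eq0 (negbTE se).
  by rewrite invr_eq0 pnatr_eq0.
have vz : bil v (val z) = 0.
  move: vm; rewrite /= bilDr !bilZr ve mulr0 addr0 => /eqP.
  by rewrite mulf_eq0 invr_eq0 pnatr_eq0 => /eqP.
have := vP z; rewrite vz sz clnV1B0 subr0 addr0 !mul1r => /esym/eqP.
by rewrite subr_eq0 => /eqP.
Qed.

(** The coordinate phi(z)_i is 2 [phi(z), e_i / 2] = 2 [phi(e_i / 2), z], which is linear in z.
    Taking z = e_j / 2 gives the symmetry. *)
Lemma bil_symmetric_linear phi :
  (forall z w, bil (val (phi z)) (val w) = bil (val (phi w)) (val z)) ->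
  exists2 A : 'M[C]_N, A^T = A & forall z, val (phi z) = A *m val z.
Proof.
move=> E.
have coord (x : 'cV[C]_N) j : bil x (val (half_delta R j)) = 2^-1 * x j 0.
  rewrite /= bilZr bilE (bigD1 j)//= big1 => [|i ij].
    by rewrite !mxE !eqxx mulr1 addr0.
  by rewrite !mxE (negbTE ij) mulr0.
have two : (2 : C) != 0 by rewrite pnatr_eq0.
pose A : 'M[C]_N := \matrix_(i, j) (2 * val (phi (half_delta R j)) i 0).
have Asym i j : A i j = A j i.
  rewrite !mxE; congr (2 * _).
  have := E (half_delta R j) (half_delta R i); rewrite !coord.
  by move=> /(mulfI (invr_neq0 two)).
exists A; first by apply/matrixP => i j; rewrite mxE Asym.
move=> z; apply/colP => i; rewrite mxE.
have := E z (half_delta R i); rewrite coord bilE.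
move=> /(congr1 (fun x => 2 * x)); rewrite mulrA mulfV// mul1r mulr_sumr => ->.
by apply: eq_bigr => j _; rewrite Asym mxE mulrA.
Qed.

(** A vector of the closed ball is shrunk by 1 / (1 + e) into the open ball, which [phi] preserves;
    so its image under [A] has norm below 1 + e. *)
Lemma opnorm_self_map_le1 phi (A : 'M[C]_N) :
  (forall z, val (phi z) = A *m val z) -> opnorm A <= 1.
Proof.
move=> phiA; apply: ge_sup.
  by exists (enorm (A *m 0)); exists 0 => //=; have := unit_ball0 R N => /ltW.
move=> _ [z /= z1 <-]; apply/ler_addgt0Pr => e e0.
have Hc := @cdot_inner R N.
pose r := (1 + e)^-1.
have r0 : 0 < r by rewrite invr_gt0; lra.
have r1 : r < 1 by rewrite invf_lt1; lra.
have nr : normc (r%:C : C) = r.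
  by rewrite /= expr0n addr0 sqrtr_sqr ger0_norm// ltW.
have rz : unit_ball (r%:C *: z).
  rewrite /unit_ball -[enorm _]/(hnorm (@cdot R N) _) (hnormZ _ Hc)// nr.
  move: z1; rewrite -[enorm _]/(hnorm (@cdot R N) _).
  by have := hnorm_ge0 (@cdot R N) z; nra.
have := valP (phi (exist (fun w : 'cV[C]_N => unit_ball w) _ rz)).
rewrite phiA /unit_ball /= -scalemxAr.
rewrite -[enorm _]/(hnorm (@cdot R N) _) (hnormZ _ Hc)// nr.
rewrite mulrC -ltr_pdivlMr// /r invrK mul1r => /ltW.
by rewrite -[enorm _]/(hnorm (@cdot R N) _).
Qed.

End Rigidity.

(* The hypotheses psi_neq0 and phi_ncst exclude the two degenerate cases in
   which the equivalence fails: psi = 0 with phi arbitrary, and phi = a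
   constant, a != 0, with psi = conjJ (dirichlet_kernel a). *)
Theorem theorem3p4 (R : realType) (N : nat) (N_gt0 : (0 < N)%N)
    (D : set (ballT R N -> R[i]))
    (ip : (ballT R N -> R[i]) -> (ballT R N -> R[i]) -> R[i])
    (dirichletD : dirichlet_space D ip)
    (phi : ballT R N -> ballT R N) (psi : ballT R N -> R[i])
    (phi_hol : holomorphic_self_map phi)
    (psi_hol : holomorphic psi)
    (W_bounded : bounded_operator D ip (weighted_comp psi phi))
    (psi_neq0 : exists z, psi z != 0)
    (phi_ncst : forall a : ballT R N, (forall z, phi z = a) -> val a = 0) :
  complex_symmetric D ip (weighted_comp psi phi) (@conjJ R N) <->
  [/\ exists c : R[i], forall z, psi z = c,
      forall z, val (phi z) = jacobian0 phi *m val z,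
      (jacobian0 phi)^T = jacobian0 phi
    & opnorm (jacobian0 phi) <= 1].
Proof.
split=> [cs|[[c psic] phiJ Jsym _]]; last first.
  (* Symmetry of the matrix gives [phi(z), w] = [z, phi(w)], by exchanging the two sums. *)
  apply: (weighted_comp_adjoint dirichletD W_bounded psic) => z w.
  rewrite !phiJ !bilE; under eq_bigr do rewrite mxE mulr_suml.
  rewrite exchange_big /=; apply: eq_bigr => i _; rewrite mxE mulr_sumr.
  by apply: eq_bigr => j _; rewrite -{1}Jsym mxE mulrAC mulrC.
have E : log_symmetric psi phi.
  by move=> z w; apply: (complex_symmetric_kernel dirichletD).
(* By [log_symmetric_weight], psi(0) = 0 would make psi vanish identically. *)
have c0 : psi (ball0 R N) != 0.
  case: psi_neq0 => z; rewrite (log_symmetric_weight z E).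
  by apply: contraNneq => ->; rewrite mul0r.
have a0 : val (phi (ball0 R N)) = 0.
  apply/eqP/negP => /negP a0.
  have /phi_ncst := log_symmetric_constant phi_hol E c0 a0.
  by apply/eqP.
have [A Asym phiA] : exists2 A : 'M[R[i]]_N, A^T = A &
    forall z, val (phi z) = A *m val z.
  (* With phi(0) = 0 the identity reduces to L([phi(z), w]) = L([phi(w), z]). *)
  apply: bil_symmetric_linear => z w; apply: clnV1B_inj; try exact: normc_bil_lt1.
  have := log_symmetric_eq z w E c0.
  by rewrite a0 !bil0l clnV1B0 !addr0 !mul1r => /addrI.
have JA := jacobian0_linear phiA; rewrite JA; split=> //.
  exists (psi (ball0 R N)) => z.
  by rewrite (log_symmetric_weight z E) a0 bil0l clnV1B0 addr0 mulr1.
exact: opnorm_self_map_le1 phiA.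
Qed.
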